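(* Let $\alpha,\beta$ be fixed real numbers with $\alpha$ irrational. Then, for every $\varepsilon>0$, the bound $$N_{\alpha,\beta}(p)\le p^{1/(4\sqrt{e})+\varepsilon}$$ holds for all sufficiently large primes $p$.
   Context: For real numbers $\alpha,\beta$ and a prime $p$, $N_{\alpha,\beta}(p)$ denotes the least positive integer $n$ such that $\lfloor \alpha n+\beta\rfloor$ is a quadratic non-residue modulo $p$ (i.e. its Legendre symbol modulo $p$ equals $-1$), with the convention $N_{\alpha,\beta}(p)=\infty$ if no such integer exists. Here $\lfloor\cdot\rfloor$ is the floor function and $e$ is the base of the natural logarithm. ''For all sufficiently large primes $p$'' means for all primes $p\ge p_0$, where $p_0$ may depend on $\alpha,\beta,\varepsilon$. *)

(* Defs.v *)
From HB Require Import structures.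
From mathcomp Require Import all_boot all_order all_algebra.
From mathcomp Require Import all_classical all_reals all_analysis.

Set Implicit Arguments.
Unset Strict Implicit.
Unset Printing Implicit Defensive.

Import Order.TTheory GRing.Theory Num.Theory.
Local Open Scope ring_scope.

(* Meaningful for p an odd prime. Squares modulo p are represented by
   residues in {0, ..., p - 1}; at p = 2 the value -1 is never taken. *)
Definition legendre (p : nat) (a : int) : int :=
  if (p%:Z %| a)%Z then 0
  else if [exists x : 'I_p, ((x : nat)%:Z ^+ 2 == a %[mod p%:Z])%Z] then 1
  else -1.

Definition nonresidue_index (R : realType) (alpha beta : R) (p : nat)
    : pred nat :=
  [pred n | (0 < n)%N &&
            (legendre p (Num.floor (alpha * n%:R + beta)) == -1)].

Definition least_nonresidue_index (R : realType) (alpha beta : R) (p : nat)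
    : \bar R :=
  if pselect (exists n, nonresidue_index alpha beta p n) is left ex_n
  then (ex_minn ex_n)%:R%:E
  else +oo%E.

(* Main.v *)
(** Let [N = p^(1/(4 sqrt e) + eps/2)].  If the quadratic nonresidues had
    density at most [eta] in [[1, y]] for every [y] between a constant [N0] and
    [N], then, counting products [q m] of a nonresidue prime [q] with residues
    [m], the sum of [1/q] over nonresidue primes [q <= N / N0] would be
    [O(eta)].  A nonresidue has a nonresidue prime factor, so by Mertens' theorem
    nonresidues would have density at most
    [log (log x / log N) + O(eta) < 1/2 - kappa] in [[1, x]], where
    [x = p^(1/4 + delta)]: this contradicts Burgess' estimate for the character
    sum of length [x].  Burgess' estimate rests on moments of short character
    sums, hence on the Weil bound for products of linear factors, which is
    obtained by Stepanov's method.

    So a positive proportion of the integers up to some [y], [N0 <= y <= N], are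
    nonresidues.  By Daboussi's theorem, proved by Katai's method uniformly in
    the character, [sum_(m <= y) chi(m) cos(k theta m + phi) = o(y)] for
    [theta = 2 pi / |alpha|] and [k >= 1], so that a Fejer kernel detects such an
    [m] in the Beatty sequence.  When [alpha < 0] and [-1] is a nonresidue,
    one needs instead a residue [m], and the same argument applies with [y] bounded
    by a constant and without Burgess' estimate. *)

Require Import Defs.
From mathcomp Require Import all_boot all_order all_algebra all_field.
From mathcomp Require Import all_classical all_reals all_analysis.
From mathcomp Require Import ring lra zify.

Set Implicit Arguments.
Unset Strict Implicit.
Unset Printing Implicit Defensive.

Import Order.TTheory GRing.Theory Num.Theory.
Local Open Scope ring_scope.

(** * Stepanov's method for y^2 = f(x) *)

(** The exponent comes from Vinogradov's trick: for x near p^(1/4), log (log x / log N) equals 1/2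
    exactly at N = p^(1/(4 sqrt e)), while a character sum o(x) forces nonresidues to have density
    about 1/2. One small nonresidue is not enough here. The Beatty condition confines m / |alpha| to
    an arc modulo 1, and only a positive density of admissible m dominates the error in
    equidistribution. The order of quantifiers is then decisive: eta depends on eps alone; the
    length of the Fejer kernel and the scale N0 are chosen after eta; p comes last. For this reason
    the threshold in Daboussi's theorem has to be independent of the multiplicative function, which
    is a quadratic character varying with p. Constants are immaterial throughout: Burgess' argument
    only uses the order sqrt p of complete sums with a fixed number of linear factors, and
    logarithms are absorbed in small powers of p. The index n is close to |m / alpha|, and this last
    factor is absorbed in half of eps. *)

(* [f ^+ (m - k) * stepanov_op f m k r] is the [k]-th derivative of [f ^+ m * r]. *)
Definition stepanov_op (F : fieldType) (f : {poly F}) (m k : nat)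
    (r : {poly F}) : {poly F} :=
  iteri k (fun i u => f^`() * u *+ (m - i) + f * u^`()) r.

Lemma stepanov_opB (F : fieldType) (f : {poly F}) m k r s :
  stepanov_op f m k (r - s) = stepanov_op f m k r - stepanov_op f m k s.
Proof.
rewrite /stepanov_op; elim: k => //= k ->.
by rewrite derivB !mulrBr mulrnBl addrACA opprD.
Qed.

(** With [f ^+ (m - k)] divided out, each derivative costs only [d] in degree, whatever [m] is. This
    keeps the linear system small although [f] occurs to a power beyond p/2. *)
Lemma size_stepanov_op (F : fieldType) (f r : {poly F}) m k d N :
  (size f <= d.+1)%N -> (size r <= N)%N ->
  (size (stepanov_op f m k r) <= N + k * d)%N.
Proof.
move=> sf sr; rewrite /stepanov_op; elim: k => [|k IH] /=; first by rewrite addn0.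
set u := iteri _ _ _ in IH *.
have [->|u0] := eqVneq u 0.
  by rewrite mulr0 mul0rn deriv0 mulr0 addr0 size_poly0.
have N0 : (0 < N + k * d)%N by apply: leq_trans IH; rewrite size_poly_gt0.
have sd (g : {poly F}) : (size g^`() <= (size g).-1)%N.
  have [->|g0] := eqVneq g 0; first by rewrite deriv0 size_poly0.
  by have := lt_size_deriv g0; rewrite -ltnS; case: (size g).
have := sd u; have := sd f => s1 s2.
apply: leq_trans (size_polyD _ _) _; rewrite geq_max.
apply/andP; split.
  rewrite -scaler_nat; apply: leq_trans (size_scale_leq _ _) _.
  apply: leq_trans (size_polyMleq _ _) _; lia.
apply: leq_trans (size_polyMleq _ _) _; lia.
Qed.

(** [Y] will be a power of X^p: in characteristic p it is a constant for the derivation. *)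
Lemma derivn_expM (F : fieldType) (f r Y : {poly F}) m k :
  Y^`() = 0 -> (k <= m)%N ->
  (f ^+ m * r * Y)^`(k) = f ^+ (m - k) * stepanov_op f m k r * Y.
Proof.
move=> dY; elim: k => [|k IH] km; first by rewrite derivn0 subn0.
rewrite derivnS IH ?(ltnW km)// /stepanov_op /=; set u := iteri _ _ _.
rewrite !derivM dY mulr0 addr0 deriv_exp -subnS.
rewrite -[in X in _ + X * _](prednK (n := m - k)) ?subn_gt0// -subnS exprS.
by rewrite -mulr_natr; ring.
Qed.

(** Taylor expansion at [a]. In characteristic p ordinary derivatives detect multiplicities only up
    to p, hence the condition on factorials. *)
Lemma dvdp_XsubC_derivn (F : fieldType) (P : {poly F}) (a : F) l :
  (forall i, (i < l)%N -> i`!%:R != 0 :> F) ->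
  (forall i, (i < l)%N -> P^`(i).[a] = 0) -> ('X - a%:P) ^+ l %| P.
Proof.
move=> fact0 der0.
have -> : P = \sum_(i < size P) (P^`N(i).[a])%:P * ('X - a%:P) ^+ i.
  (* Taylor's formula over [{poly F}], at the two points [a%:P] and ['X - a%:P], whose sum is
     ['X]. *)
  have := @nderiv_taylor _ (map_poly polyC P) a%:P ('X - a%:P).
  rewrite [a%:P + _]addrC subrK -[_.['X]]/(P \Po 'X) comp_polyXr size_map_polyC.
  move=> /(_ (mulrC _ _)) {1}->; apply: eq_bigr => i _.
  by rewrite nderivn_map horner_map.
apply: (big_ind (fun q => _ %| q)) => [|q r|i _]; [exact: dvdp0|exact: dvdp_add|].
have [il|li] := ltnP i l; last by rewrite dvdp_mull// dvdp_exp2l.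
have := der0 _ il; rewrite nderivn_def hornerMn -mulr_natr => /eqP.
by rewrite mulf_eq0 (negPf (fact0 _ il)) orbF => /eqP ->; rewrite mul0r dvdp0.
Qed.

Lemma dvdp_prod_XsubC_exp (F : fieldType) (P : {poly F}) (s : seq F) l :
  uniq s -> {in s, forall a, ('X - a%:P) ^+ l %| P} ->
  \prod_(a <- s) ('X - a%:P) ^+ l %| P.
Proof.
elim: s => [|a s IH] /=; first by rewrite big_nil dvd1p.
case/andP=> as_ us H; rewrite big_cons Gauss_dvdp; last first.
  rewrite prodrXl coprimep_expl// coprimep_expr// coprimep_sym.
  by rewrite coprimep_XsubC root_prod_XsubC.
rewrite H ?mem_head//= IH// => b bs; apply: H; exact: mem_behead.
Qed.

Lemma size_multiple_roots (F : fieldType) (P : {poly F}) (s : seq F) l :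
  P != 0 -> uniq s -> (forall i, (i < l)%N -> i`!%:R != 0 :> F) ->
  {in s, forall a i, (i < l)%N -> P^`(i).[a] = 0} ->
  (size s * l < size P)%N.
Proof.
move=> P0 us fact0 der0.
have /(dvdp_leq P0) : \prod_(a <- s) ('X - a%:P) ^+ l %| P.
  apply: dvdp_prod_XsubC_exp => // a sa.
  by apply: dvdp_XsubC_derivn => // i; apply: der0.
rewrite prodrXl; set Q := \prod_(_ <- _) _.
have Q0 : (0 < size (Q ^+ l))%N.
  by rewrite size_poly_gt0 expf_neq0// -size_poly_gt0 size_prod_XsubC.
move=> le; have := size_exp Q l; rewrite size_prod_XsubC /= => e.
by rewrite -e prednK.
Qed.

(* Over a finite field, this replaces the dimension count for linear systems. *)
Lemma additive_kernel (U V : finZmodType) (phi : U -> V) :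
  {morph phi : x y / x - y} -> (#|V| < #|U|)%N ->
  exists2 u, u != 0 & phi u = 0.
Proof.
move=> phiB lt.
have /injectivePn [x [y xy e]] : ~~ injectiveb phi.
  apply/negP => /injectiveP inj; have := leq_card phi inj.
  by rewrite leqNgt lt.
by exists (x - y); rewrite ?subr_eq0// phiB e subrr.
Qed.

(* If [X^p] divides [r + s f^((p-1)/2)] then it divides [r^2 f - s^2 f^p],
   hence [r^2 f - s^2 f(0)^p], which has degree less than [p]. *)
Lemma stepanov_indep (F : fieldType) (p h A d : nat) (f r s : {poly F}) (z : F) :
  p \in [pchar F] -> p = h.*2.+1 -> (A.*2 + d <= p)%N ->
  size f = d.+1 -> f`_0 != 0 -> odd (mup z f) ->
  (size r <= A)%N -> (size s <= A)%N ->
  'X^p %| r + s * f ^+ h -> r = 0 /\ s = 0.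
Proof.
move=> chF ph Adp sf f0 oddf sr ss dv.
have pp : prime p by apply: pcharf_prime chF.
have chP : p \in [pchar {poly F}] by rewrite pchar_poly.
have dv1 : 'X^p %| f ^+ p - (f`_0 ^+ p)%:P.
  rewrite polyC_exp -(pFrobenius_autE chP) -(pFrobenius_autE chP).
  rewrite -pFrobenius_autB_comm; last exact: mulrC.
  rewrite pFrobenius_autE dvdp_exp2r//.
  have /polyXsubCP : (f - (f`_0)%:P).[0] = 0.
    by rewrite hornerD hornerN hornerC -horner_coef0 subrr.
  by rewrite subr0.
set c := (f`_0 ^+ p)%:P in dv1.
have dv2 : 'X^p %| r ^+ 2 * f - s ^+ 2 * c.
  have -> : r ^+ 2 * f - s ^+ 2 * c =
    (r + s * f ^+ h) * ((r - s * f ^+ h) * f) + (f ^+ p - c) * s ^+ 2.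
    have -> : f ^+ p = f * (f ^+ h * f ^+ h) by rewrite ph exprS -addnn exprD.
    ring.
  by apply: dvdp_add; apply: dvdp_mulr.
have f_n0 : f != 0 by rewrite -size_poly_gt0 sf.
have c0 : c != 0 by rewrite polyC_eq0 expf_neq0.
have sz (t g : {poly F}) : (size t <= A)%N -> (size g <= d.+1)%N -> (size (t ^+ 2 *
    g)%R <= p)%N.
  move=> st sg; have [->|t0] := eqVneq t 0; first by rewrite expr0n mul0r size_poly0.
  apply: leq_trans (size_polyMleq _ _) _; rewrite expr2.
  have := size_polyMleq t t; rewrite -size_poly_gt0 in t0.
  move: t0 st sg Adp; move: (size (t * t)) (size t) (size g); clear; lia.
have /eqP eq : r ^+ 2 * f - s ^+ 2 * c == 0.
  rewrite -size_poly_eq0 -leqn0 leqNgt; apply/negP => gt0.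
  move: dv2 => /dvdp_leq; rewrite -size_poly_gt0 => /(_ gt0).
  rewrite size_polyXn ltnNge => /negP; apply.
  apply: leq_trans (size_polyD _ _) _; rewrite size_polyN geq_max !sz ?sf//.
  by rewrite size_polyC; case: (_ != 0).
have eq' : r ^+ 2 * f = s ^+ 2 * c by apply/eqP; rewrite -subr_eq0 eq.
have [r0|r0] := eqVneq r 0.
  split=> //; move: eq'; rewrite r0 expr0n mul0r => /esym/eqP.
  by rewrite mulf_eq0 (negPf c0) orbF expf_eq0 /= => /eqP.
have s0 : s != 0.
  apply: contraNneq r0 => s0; move: eq'; rewrite s0 expr0n mul0r => /eqP.
  by rewrite mulf_eq0 (negPf f_n0) orbF expf_eq0.
(* At [z] the left side has odd multiplicity and the right side even multiplicity, [c] being a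
   nonzero constant. *)
have /(congr1 (fun q => odd (mup z q))) := eq'.
rewrite !expr2 !mupM ?mulf_neq0// !oddD !addbb oddf.
by rewrite mupNroot // rootC expf_neq0.
Qed.

(** Modulo X^p only the block j = 0 is left, so it vanishes by the case of one block; then X^p
    cancels and the argument repeats. *)
Lemma stepanov_indep_sum (F : fieldType) (p h A d : nat) (f : {poly F}) (z : F)
    J (r s : nat -> {poly F}) :
  p \in [pchar F] -> p = h.*2.+1 -> (A.*2 + d <= p)%N ->
  size f = d.+1 -> f`_0 != 0 -> odd (mup z f) ->
  (forall j, (size (r j) <= A)%N) -> (forall j, (size (s j) <= A)%N) ->
  \sum_(j < J) (r j + s j * f ^+ h) * 'X^(p * j) = 0 ->
  forall j, (j < J)%N -> r j = 0 /\ s j = 0.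
Proof.
move=> chF ph Adp sf f0 oddf; elim: J r s => [|J IH] r s sr ss; first by [].
rewrite big_ord_recl muln0 expr0 mulr1.
under eq_bigr do rewrite lift0 mulnS exprD mulrCA.
rewrite -mulr_sumr => e0.
have [r0 s0] : r 0%N = 0 /\ s 0%N = 0.
  apply: (stepanov_indep chF ph Adp sf f0 oddf) => //.
  by have /eqP := e0; rewrite addr_eq0 => /eqP ->; rewrite dvdpNr dvdp_mulr.
move: e0; rewrite r0 s0 mul0r !add0r => /eqP.
rewrite mulf_eq0 expf_eq0 polyX_eq0 andbF /= => /eqP e.
case=> [//|j]; rewrite ltnS.
exact: (IH (fun j => r j.+1) (fun j => s j.+1)).
Qed.

Definition row_poly (F : fieldType) J A (M : 'M[F]_(J, A)) (j : nat) : {poly F} :=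
  oapp (fun i : 'I_J => rVpoly (row i M)) 0 (insub j).

Lemma row_polyB (F : fieldType) J A (M N : 'M[F]_(J, A)) j :
  row_poly (M - N) j = row_poly M j - row_poly N j.
Proof.
rewrite /row_poly; case: insubP => [i _ _|_] /=; last by rewrite subr0.
by rewrite !linearB.
Qed.

Lemma size_row_poly (F : fieldType) J A (M : 'M[F]_(J, A)) j :
  (size (row_poly M j) <= A)%N.
Proof.
rewrite /row_poly; case: insubP => [i _ _|_] /=; last by rewrite size_poly0.
exact: size_poly.
Qed.

Lemma row_poly_eq0 (F : fieldType) J A (M : 'M[F]_(J, A)) :
  (forall j, (j < J)%N -> row_poly M j = 0) -> M = 0.
Proof.
move=> H; apply/row_matrixP => i; rewrite row0.
have := H i (ltn_ord i); rewrite /row_poly valK /= => e.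
by rewrite -[row i M]rVpolyK e linear0.
Qed.

Lemma prime_ndvd_fact p i : prime p -> (i < p)%N -> ~~ (p %| i`!)%N.
Proof.
move=> pp; elim: i => [|i IH] ip; first by rewrite fact0 dvdn1 neq_ltn prime_gt1 ?orbT.
by rewrite factS Euclid_dvdM// negb_or IH ?(ltnW ip)// andbT gtnNdvd.
Qed.

Lemma Fp_expp (p : nat) (x : 'F_p) : prime p -> x ^+ p = x.
Proof. by move=> pp; have := expf_card x; rewrite card_Fp. Qed.

(* The auxiliary polynomial is [f^l * sum_j (r_j + s_j f^h) X^(p j)].  At a point
   [x] of the set, [f(x)^h = a] and [x^p = x], so that its derivatives of order
   [k < l] vanish as soon as the polynomials [T M N k] do, which is a linear
   system in the coefficients of the [r_j] and [s_j] (the rows of [M], [N]). *)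
Lemma stepanov_count (p h A J l d : nat) (f : {poly 'F_p}) (z a : 'F_p) :
  prime p -> p = h.*2.+1 -> (A.*2 + d <= p)%N -> (l <= p)%N ->
  (l * (A + J + l * d) < A.*2 * J)%N ->
  size f = d.+1 -> f`_0 != 0 -> odd (mup z f) ->
  (#|[set x : 'F_p | (f.[x] != 0) && (f.[x] ^+ h == a)]%R| * l <=
     l * d + d * h + A + p * J)%N.
Proof.
move=> pp ph Adp lp cnt sf f0 oddf.
have chF : p \in [pchar 'F_p] := pchar_Fp pp.
pose m := (l + h)%N.
pose T (M N : 'M['F_p]_(J, A)) (k : nat) : {poly 'F_p} :=
  \sum_(j < J) (stepanov_op f l k (row_poly M j) +
                a%:P * stepanov_op f m k (row_poly N j)) * 'X^j.
pose E := (A + J + l * d)%N.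
(* Having X^j in place of X^(p j) keeps [T M N k] short: each of the [l] derivatives imposes at most
   [E] linear conditions on the 2 A J unknown coefficients. *)
have sT M N k : (k < l)%N -> (size (T M N k) <= E)%N.
  move=> kl; apply: (big_ind (fun q : {poly 'F_p} => size q <= E)%N).
  - by rewrite size_poly0.
  - by move=> q r sq sr; apply: leq_trans (size_polyD _ _) _; rewrite geq_max sq.
  move=> j _; apply: leq_trans (size_polyMleq _ _) _; rewrite size_polyXn addnS /=.
  have s1 (b : 'M['F_p]_(J, A)) n :
      (size (stepanov_op f n k (row_poly b j)) <= A + k * d)%N.
    by apply: size_stepanov_op; [rewrite sf | exact: size_row_poly].
  set q := _ + _; have : (size q <= A + k * d)%N.
    apply: leq_trans (size_polyD _ _) _; rewrite geq_max s1 /=.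
    by rewrite mul_polyC; apply: leq_trans (size_scale_leq _ _) (s1 _ _).
  have := ltn_ord j; have : (k * d <= l * d)%N by rewrite leq_mul2r ltnW ?orbT.
  rewrite /E; move: (size q) (k * d)%N (l * d)%N (nat_of_ord j); clear; lia.
pose phi (u : 'M['F_p]_(J + J, A)) : 'M['F_p]_(l, E) :=
  \matrix_(k < l) poly_rV (T (usubmx u) (dsubmx u) k).
have [||u u0 phi0] := @additive_kernel 'M['F_p]_(J + J, A) 'M['F_p]_(l, E) phi.
- move=> u v; apply/row_matrixP => k; rewrite raddfB /= !rowK /=.
  rewrite -raddfB /=; congr poly_rV; rewrite /T -sumrB; apply: eq_bigr => j _.
  rewrite !linearB /= !row_polyB !stepanov_opB; ring.
- rewrite !card_mx card_Fp// ltn_exp2l ?prime_gt1//.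
  by move: cnt; rewrite /E; lia.
set M := usubmx u in phi0; set N := dsubmx u in phi0.
have T0 k : (k < l)%N -> T M N k = 0.
  move=> kl; have := congr1 (row (Ordinal kl)) phi0; rewrite rowK row0 /= => e.
  by rewrite -(poly_rV_K (sT M N k kl)) e linear0.
pose P := \sum_(j < J) (f ^+ l * row_poly M j * 'X^(p * j) + f ^+ m * row_poly N j *
    'X^(p * j)).
have dX j : ('X^(p * j) : {poly 'F_p})^`() = 0.
  by rewrite derivXn -mulr_natr natrM -polyC_natr (pcharf0 chF) mul0r mulr0.
have PE : P = f ^+ l * \sum_(j < J) (row_poly M j + row_poly N j * f ^+ h) * 'X^(p * j).
  rewrite mulr_sumr; apply: eq_bigr => j _; rewrite /m exprD; ring.
have P0 : P != 0.
  rewrite PE mulf_neq0//; first by rewrite expf_neq0 // -size_poly_gt0 sf.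
  apply: contraNneq u0 => /(stepanov_indep_sum chF ph Adp sf f0 oddf
    (fun j => size_row_poly M j) (fun j => size_row_poly N j)) H.
  rewrite -[u]vsubmxK -/M -/N.
  have -> : M = 0 by apply: row_poly_eq0 => j /H [].
  have -> : N = 0 by apply: row_poly_eq0 => j /H [].
  by rewrite col_mx0.
have sP : (size P <= l * d + d * h + A + p * J)%N.
  apply: (big_ind (fun q : {poly 'F_p} => size q <= l * d + d * h + A + p * J)%N).
  - by rewrite size_poly0.
  - by move=> q r sq sr; apply: leq_trans (size_polyD _ _) _; rewrite geq_max sq.
  move=> j _; have jJ : (p * j + p <= p * J)%N
    by rewrite addnC -mulnS leq_mul2l ltn_ord orbT.
  have p0 : (0 < p)%N := prime_gt0 pp.
  have H n (b : 'M['F_p]_(J, A)) :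
      (n <= m)%N -> (size (f ^+ n * row_poly b j * 'X^(p * j))%R <= l * d + d * h + A
          + p * J)%N.
    move=> nm; have nd : (n * d <= m * d)%N by rewrite leq_mul2r nm orbT.
    apply: leq_trans (size_polyMleq _ _) _; rewrite size_polyXn addnS /=.
    have := size_polyMleq (f ^+ n) (row_poly b j).
    have := size_poly_exp_leq f n; rewrite sf /=; have := size_row_poly b j.
    move: nd; rewrite /m mulnDl; move:
        (size (f ^+ n * _)) (size (f ^+ n)) (size (row_poly b j)) jJ p0.
    rewrite (mulnC n) (mulnC h).
    move: (d * n)%N (l * d)%N (d * h)%N (p * j)%N (p * J)%N; clear; lia.
  apply: leq_trans (size_polyD _ _) _; rewrite geq_max !H// /m leq_addr //.
apply: leq_trans sP; apply: ltnW; rewrite cardE.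
apply: size_multiple_roots => //; first exact: enum_uniq.
  by move=> i il; rewrite -(dvdn_pcharf chF) prime_ndvd_fact// (leq_trans il).
move=> x; rewrite mem_enum inE => /andP[fx /eqP fxa] k kl.
have km : (k <= m)%N by rewrite (leq_trans (ltnW kl)) ?leq_addr.
rewrite /P raddf_sum /= horner_sum.
transitivity (f.[x] ^+ (l - k) * (T M N k).[x]); last by rewrite T0 // horner0 mulr0.
rewrite /T horner_sum mulr_sumr; apply: eq_bigr => j _.
rewrite derivnD !derivn_expM ?dX ?(ltnW kl)// !(hornerE, horner_exp).
have -> : x ^+ (p * j) = x ^+ j by rewrite exprM Fp_expp.
rewrite (_ : (m - k = l - k + h)%N); last by rewrite /m; lia.
rewrite exprD fxa /=; ring.
Qed.

Lemma even_sqrt_approx (p : nat) :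
  exists k, ((k * 2) ^ 2 <= p < (k * 2 + 2) ^ 2)%N.
Proof.
have ex0 : exists k, ((k * 2) ^ 2 <= p)%N by exists 0%N.
have bnd k : ((k * 2) ^ 2 <= p)%N -> (k <= p)%N by rewrite expnS; nia.
case: (ex_maxnP ex0 bnd) => k kp kmax; exists k; rewrite kp ltnNge /=.
apply/negP => H; have := kmax k.+1; rewrite mulSn addnC H ltnn => /(_ isT) //.
Qed.

(** In [stepanov_count], take l = 2k close to sqrt p, A close to p/2 and J = l/2 + d + 1. The excess
    2 A J - l A is about p (d + 1), which beats l^2 d + l J; dividing the degree bound by l leaves
    p/2 + O((d + 1) sqrt p). *)
Lemma stepanov_bound (p d k : nat) (f : {poly 'F_p}) (z a : 'F_p) :
  prime p -> odd p -> (16 * d.+1 ^ 2 <= p)%N ->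
  ((k * 2) ^ 2 <= p < (k * 2 + 2) ^ 2)%N ->
  size f = d.+1 -> f`_0 != 0 -> odd (mup z f) ->
  (#|[set x : 'F_p | (f.[x] != 0) && (f.[x] ^+ p./2 == a)]%R| * 2 <=
     p + 2 * d + 32 * d.+1 * k)%N.
Proof.
move=> pp oddp dp /andP[kp pk] sf f0 oddf.
have ph : p = (p./2).*2.+1 by rewrite -[LHS]odd_double_half oddp.
set h := p./2 in ph *.
pose A := ((p - d)./2)%N.
have Ap : (p - d <= A * 2 + 1)%N by rewrite /A; lia.
have Ap2 : (A * 2 <= p - d)%N by rewrite /A; lia.
have k0 : (0 < k)%N by move: dp kp pk; rewrite !expnS !expn0; nia.
have dle : (d.+1 <= p)%N by move: dp; rewrite !expnS; nia.
have am : (8 * (k * 2) * d.+1 <= (k * 2) ^ 2 + 16 * d.+1 ^ 2)%N.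
  by have [+ _] := nat_Cauchy (k * 2) (4 * d.+1); rewrite !expnS !expn0; lia.
have key := @stepanov_count p h A (k + d.+1) (k * 2) d f z a pp ph.
set n := #|_| in key *.
have D2 : (16 * (d.+1 * d.+1) <= p)%N by move: dp; rewrite !expnS expn0 muln1.
have k2 : (4 * (k * k) <= p)%N by move: kp; rewrite !expnS expn0; lia.
have {key} : (n * (k * 2) <= k * 2 * d + d * h + A + p * (k + d.+1))%N.
  by apply: key => //; [lia | lia | nia].
have pk2 : (p <= 16 * (k * k))%N.
  have kk : (k <= k * k)%N by rewrite leq_pmulr.
  by move: pk; rewrite !expnS expn0; lia.
have pkD : (p * d.+1 <= 16 * (k * k) * d.+1)%N by rewrite leq_mul2r pk2 orbT.
have hd : (d * (h * 2) <= d * p)%N by rewrite leq_mul2l; lia.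
move=> H; rewrite -(leq_pmul2r (_ : 0 < k * 2)%N) ?muln_gt0 ?k0//.
move: H pkD hd Ap2 (ph); clear; move: n => n; nia.
Qed.

(** * Quadratic character sums *)

Definition qchar (R : pzRingType) (p : nat) (x : 'F_p) : R :=
  if x == 0 then 0 else if x ^+ p./2 == 1 then 1 else -1.

Lemma Fp_exp_half (p : nat) (x : 'F_p) : prime p -> odd p -> x != 0 ->
  x ^+ p./2 = 1 \/ x ^+ p./2 = -1.
Proof.
move=> pp oddp x0; have := Fp_expp x pp.
have -> : x ^+ p = x * (x ^+ p./2) ^+ 2.
  rewrite -exprM -exprS muln2; congr (_ ^+ _).
  by rewrite -[LHS](odd_double_half p) oddp.
rewrite -[in RHS](mulr1 x) => /(mulfI x0) /eqP; rewrite sqrf_eq1 => /orP[]/eqP;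
    [by left|by right].
Qed.

Lemma Fp_opp1_neq1 (p : nat) : prime p -> odd p -> (-1 : 'F_p) != 1.
Proof.
move=> pp oddp; rewrite eq_sym -subr_eq0 opprK -(natrD _ 1 1) -(dvdn_pcharf (pchar_Fp
    pp)).
apply/negP => /dvdn_leq; case: p pp oddp => [|[|[|p]]] //= _ _ /(_ isT); lia.
Qed.

Lemma qcharM (R : pzRingType) (p : nat) (x y : 'F_p) : prime p -> odd p ->
  qchar R (x * y) = qchar R x * qchar R y.
Proof.
move=> pp oddp; rewrite /qchar mulf_eq0.
have [|x0] := eqVneq x 0; first by rewrite mul0r.
have [|y0] := eqVneq y 0; first by rewrite mulr0.
rewrite exprMn; have n1 := negPf (Fp_opp1_neq1 pp oddp).
by case: (Fp_exp_half pp oddp x0) (Fp_exp_half pp oddp y0) => -> [] ->;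
  rewrite ?mul1r ?mulr1 ?mulrNN ?mulr1 ?n1 ?eqxx ?mulN1r ?mulrN1 ?opprK.
Qed.

Lemma qchar1 (R : pzRingType) (p : nat) : qchar R (1 : 'F_p) = 1.
Proof. by rewrite /qchar oner_eq0 expr1n eqxx. Qed.

Lemma qchar_prod (R : comPzRingType) (p : nat) (I : finType) (F : I -> 'F_p) :
  prime p -> odd p -> qchar R (\prod_i F i) = \prod_i qchar R (F i).
Proof.
move=> pp oddp; apply: (big_morph (@qchar R p)); last exact: qchar1.
by move=> x y; apply: qcharM.
Qed.

Lemma normr_qchar_le1 (R : numDomainType) (p : nat) (x : 'F_p) : `|qchar R x| <= 1.
Proof. by rewrite /qchar; case: ifP; rewrite ?normr0 ?ler01//; case: ifP;
    rewrite ?normrN normr1. Qed.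

(** Stepanov's method bounds the counts [N 1] and [N (-1)] from above only. As they add up to at
    least p - d, the upper bound for one is a lower bound for the other, which controls their
    difference on both sides. *)
Lemma sum_qchar_bound (R : rcfType) (p d : nat) (f : {poly 'F_p}) (z : 'F_p) :
  prime p -> odd p -> (16 * d.+1 ^ 2 <= p)%N ->
  size f = d.+1 -> f`_0 != 0 -> odd (mup z f) ->
  `|\sum_(x : 'F_p) qchar R f.[x]| <= 19 * d.+1%:R * Num.sqrt p%:R.
Proof.
move=> pp oddp dp sf f0 oddf.
have [k /andP[kp pk]] := even_sqrt_approx p.
pose N (a : 'F_p) := #|[set x : 'F_p | (f.[x] != 0) && (f.[x] ^+ p./2 == a)]|.
have n1 := Fp_opp1_neq1 pp oddp.
have sE : \sum_(x : 'F_p) qchar R f.[x] = (N 1)%:R - (N (-1))%:R.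
  rewrite /N -!sum1_card !natr_sum.
  rewrite [X in _ = X - _]big_mkcond [X in _ = _ - X]big_mkcond /= -sumrB;
      apply: eq_bigr => x _.
  rewrite !inE /qchar; have [|fx] := eqVneq f.[x] 0; first by rewrite subr0.
  case: (Fp_exp_half pp oddp fx) => -> /=; rewrite ?eqxx ?(negPf n1) ?sub0r//.
  by rewrite eq_sym (negPf n1) subr0.
have N0 : (#|[set x : 'F_p | f.[x] == 0]%R| <= d)%N.
  have fn0 : f != 0 by rewrite -size_poly_gt0 sf.
  have := max_poly_roots fn0 _ (enum_uniq [set x : 'F_p | f.[x] == 0]).
  rewrite -cardE sf ltnS; apply; apply/allP => x; rewrite mem_enum inE.
  by rewrite /root.
have tot : (p <= N 1%R + N (-1)%R + d)%N.
  rewrite -[X in (X <= _)%N](card_Fp pp) -cardsT.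
  apply: leq_trans (leq_add (leqnn _) N0); rewrite /N.
  set A := [set _ | _]; set B := [set _ | _]; set C := [set _ | _].
  have -> : [set: 'F_p] = (A :|: B) :|: C.
    apply/setP => x; rewrite !inE; have [//|fx /=] := eqVneq f.[x] 0.
    by case: (Fp_exp_half pp oddp fx) => ->; rewrite eqxx ?orbT.
  apply: leq_trans (leq_card_setU _ _) _; rewrite leq_add2r.
  exact: leq_card_setU.
have nb a : (N a * 2 <= p + 2 * d + 32 * d.+1 * k)%N
  by apply: (@stepanov_bound p d k f z a) => //; rewrite kp pk.
have s0 : 0 <= Num.sqrt p%:R :> R := sqrtr_ge0 _.
have sq2 : Num.sqrt p%:R ^+ 2 = p%:R :> R by rewrite sqr_sqrtr ?ler0n.
have sq : (k * 2)%:R <= Num.sqrt p%:R :> R.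
  by rewrite -ler_sqr ?nnegrE ?ler0n// sq2 -natrX ler_nat.
have s1 : 1 <= Num.sqrt p%:R :> R.
  by rewrite -ler_sqr ?nnegrE// sq2 expr1n ler1n prime_gt0.
have nbR a : (N a)%:R * 2 <= p%:R + 2 * d%:R + 32 * (d%:R + 1) * k%:R :> R.
  have := nb a; rewrite -(ler_nat R) natrM (natrD _ (p + 2 * d)) (natrD _ p).
  by rewrite (natrM _ (32 * d.+1)) (natrM _ 32) (natrM _ 2) -[d.+1%:R]natr1.
rewrite natrM in sq; rewrite sE ler_norml; move: (nbR 1) (nbR (-1)) tot.
rewrite -!(ler_nat R) !natrD.
have Dk : d.+1%:R * (k%:R * 2) <= d.+1%:R * Num.sqrt p%:R :> R.
  by rewrite ler_wpM2l ?ler0n.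
have D1 : d.+1%:R * 1 <= d.+1%:R * Num.sqrt p%:R :> R by rewrite ler_wpM2l ?ler0n.
move: Dk D1; rewrite -[d.+1%:R]natr1 => Dk D1 *.
by apply/andP; split; lra.
Qed.

(* A function all of whose fibres are even takes at most [r] values, so it
   factors through ['I_r]. *)
Lemma card_even_fibers (r : nat) (T : finType) :
  (#|[set f : {ffun 'I_r.*2 -> T} | [forall v, ~~ odd #|[set i | f i == v]|]]|
   <= r ^ r.*2 * #|T| ^ r)%N.
Proof.
case: r => [|r].
  rewrite !expn0 muln1; apply: leq_trans (max_card _) _.
  by rewrite card_ffun card_ord.
pose comp (kh : {ffun 'I_r.+1.*2 -> 'I_r.+1} * {ffun 'I_r.+1 -> T}) :=
  [ffun i => kh.2 (kh.1 i)].
apply: (@leq_trans #|comp @: [set: _]|); last first.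
  apply: leq_trans (leq_imset_card _ _) _.
  by rewrite cardsT card_prod !card_ffun !card_ord.
apply/subset_leq_card/fintype.subsetP => f; rewrite inE => /forallP evenf.
pose im := [set f i | i : 'I_r.+1.*2].
have szim : (#|im| <= r.+1)%N.
  rewrite -leq_double.
  have -> : r.+1.*2 = (\sum_(i < r.+1.*2) 1)%N by rewrite sum1_card card_ord.
  rewrite (partition_big (fun i => f i) (fun v => v \in im)) /=; last first.
    by move=> i _; apply: imset_f.
  rewrite -mul2n mulnC -sum_nat_const; apply: leq_sum => v /imsetP[i _ vE].
  rewrite sum1_card; have := evenf v.
  have <- : #|[set i | f i == v]| = #|[pred i | f i == v]|.
    by apply: eq_card => j; rewrite !inE.
  have : (0 < #|[set i | f i == v]|)%N by apply/card_gt0P; exists i; rewrite inE vE.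
  by case: #|_| => [|[|]].
have idx i : (index (f i) (enum im) < r.+1)%N.
  apply: leq_trans szim; rewrite cardE index_mem mem_enum; exact: imset_f.
apply/imsetP; exists ([ffun i => Ordinal (idx i)],
   [ffun j : 'I_r.+1 => nth (f ord0) (enum im) j]); first by rewrite inE.
by apply/ffunP => i; rewrite !ffunE /= nth_index// mem_enum imset_f.
Qed.

Lemma natr_Fp_inj (p : nat) (a b : nat) : prime p -> (a < p)%N -> (b < p)%N ->
  a%:R = b%:R :> 'F_p -> a = b.
Proof.
move=> pp ap bp /(congr1 (fun x : 'F_p => nat_of_ord x)).
by rewrite /= !val_Fp_nat ?prime_gt1// !modn_small.
Qed.

(** Expanding the power gives, for each choice [f] of 2r shifts, a complete sum over a product of
    linear factors. Choices with all multiplicities even are few and get the trivial bound p; any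
    other choice has a shift of odd multiplicity, which is the root of odd multiplicity that
    [sum_qchar_bound] asks for. *)
Lemma qchar_sum_moment (R : rcfType) (p B r : nat) :
  prime p -> odd p -> (B < p)%N -> (16 * r.*2.+1 ^ 2 <= p)%N ->
  \sum_(u : 'F_p) (\sum_(b < B) qchar R (u + b.+1%:R)) ^+ r.*2 <=
  (r ^ r.*2 * B ^ r)%:R * p%:R + B%:R ^+ r.*2 * (19 * r.*2.+1%:R * Num.sqrt p%:R).
Proof.
move=> pp oddp Bp rp.
under eq_bigr => u _.
  rewrite -[in X in _ ^+ X](card_ord r.*2) -prodr_const bigA_distr_bigA /=. over.
rewrite exchange_big /=.
pose ev := [set f : {ffun 'I_r.*2 -> 'I_B} | [forall v, ~~ odd #|[set i | f i == v]|]].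
rewrite (bigID (mem ev)) /=; apply: lerD.
  apply: (@le_trans _ _ (\sum_(f in ev) p%:R)).
    apply: ler_sum => f _; rewrite -[X in X%:R](card_Fp pp) -sum1_card natr_sum.
    apply: ler_sum => u _; rewrite -qchar_prod//.
    exact: le_trans (ler_norm _) (normr_qchar_le1 _ _).
  rewrite sumr_const -[_ *+ #|_|]mulr_natl ler_wpM2r ?ler0n// ler_nat.
  by have := card_even_fibers r 'I_B; rewrite card_ord.
apply: (@le_trans _ _ (\sum_(f : {ffun 'I_r.*2 -> 'I_B} | f \notin ev)
   19 * r.*2.+1%:R * Num.sqrt p%:R)); last first.
  rewrite sumr_const -[_ *+ #|_|]mulr_natl ler_wpM2r ?mulr_ge0 ?sqrtr_ge0 ?ler0n//.
  rewrite -natrX ler_nat -[B in (B ^ _)%N]card_ord -[X in (_ ^ X)%N](card_ord r.*2).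
  by rewrite -card_ffun max_card.
apply: ler_sum => f; rewrite inE negb_forall => /existsP[v]; rewrite negbK => oddv.
pose s := [seq - ((f i).+1%:R : 'F_p) | i <- enum 'I_r.*2].
pose P : {poly 'F_p} := \prod_(a <- s) ('X - a%:P).
have PE u : P.[u] = \prod_i (u + (f i).+1%:R).
  rewrite /P horner_prod big_map big_enum /=; apply: eq_bigr => i _.
  by rewrite !hornerE opprK.
(* The shifts run over 1, ..., B and not from 0, so that [P] has a nonzero constant coefficient. *)
have bn0 (b : 'I_B) : b.+1%:R != 0 :> 'F_p.
  rewrite -(dvdn_pcharf (pchar_Fp pp)) gtnNdvd//; exact: leq_ltn_trans Bp.
under eq_bigr do rewrite -qchar_prod// -PE.
apply: le_trans (ler_norm _) _.
apply: (@sum_qchar_bound R p r.*2 P (- v.+1%:R)) => //.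
- by rewrite size_prod_XsubC size_map size_enum_ord.
- rewrite -horner_coef0 PE; apply/prodf_neq0 => i _; rewrite add0r; exact: bn0.
rewrite mu_prod_XsubC count_map -sum1_count big_enum_cond /= sum1_card.
rewrite (_ : #|_| = #|[set i | f i == v]|) //; apply: eq_card => i; rewrite inE;
    change ((- (f i).+1%:R == - v.+1%:R :> 'F_p) = (f i == v)); rewrite eqr_opp.
apply/eqP/eqP => [e|->//]; apply: val_inj; apply/succn_inj.
by apply: (natr_Fp_inj pp) => //; apply: leq_ltn_trans Bp; exact: ltn_ord.
Qed.

(** * Burgess' method *)

Lemma sum_Cauchy_Schwarz (R : realFieldType) (I : finType) (P : pred I) (a b : I -> R) :
  (\sum_(i | P i) a i * b i) ^+ 2 <= (\sum_(i | P i) a i ^+ 2) * (\sum_(i | P i) b i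
      ^+ 2).
Proof.
set X := \sum_(i | P i) a i ^+ 2; set Y := \sum_(i | P i) b i ^+ 2.
set Z := \sum_(i | P i) _.
have X0 : 0 <= X by apply: sumr_ge0 => i _; exact: sqr_ge0.
have key t : 0 <= X * t ^+ 2 + 2 * t * Z + Y.
  rewrite /X /Y /Z mulr_suml mulr_sumr -!big_split /=.
  by apply: sumr_ge0 => i _; have := sqr_ge0 (a i * t + b i); lra.
have [X00|Xn0] := eqVneq X 0.
  have ai i : P i -> a i = 0.
    by move=> Pi; move/psumr_eq0P: X00 => /(_ (fun i _ => sqr_ge0 (a i)) i Pi) /eqP;
        rewrite sqrf_eq0 => /eqP.
  rewrite X00 mul0r /Z big1 ?expr0n// => i Pi; by rewrite ai// mul0r.
have Xp : 0 < X by rewrite lt_def Xn0.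
have := key (- Z / X); rewrite -(ler_pM2l Xp) mulr0.
have -> : X * (X * (- Z / X) ^+ 2 + 2 * (- Z / X) * Z + Y) = X * Y - Z ^+ 2 by field.
by rewrite subr_ge0.
Qed.

Lemma sum_shift_bound (R : realDomainType) (F : nat -> R) x c :
  (forall n, `|F n| <= 1) ->
  `|\sum_(n < x) F n - \sum_(n < x) F (n + c)%N| <= 2 * c%:R.
Proof.
move=> F1; elim: c => [|c IH].
  by under [X in _ - X]eq_bigr do rewrite addn0; rewrite subrr normr0 mulr0.
have e : \sum_(n < x) F (n + c)%N - \sum_(n < x) F (n + c.+1)%N = F c - F (x + c)%N.
  have := @big_ord_recl _ 0 +%R x (fun n => F (n + c)%N).
  rewrite big_ord_recr /= add0n => e1.
  have -> : \sum_(n < x) F (n + c.+1)%N = \sum_(n < x) F (bump 0 n + c)%N.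
    by apply: eq_bigr => n _; rewrite /bump add1n addSnnS.
  lra.
have := ler_normB (F c) (F (x + c)%N); have := F1 c; have := F1 (x + c)%N.
move: IH; set S := \sum_(n < x) F n; set S1 := \sum_(n < x) F (n + c)%N in e *.
set S2 := \sum_(n < x) _ in e * => IH f1 f2 f3.
have -> : S - S2 = (S - S1) + (F c - F (x + c)%N) by rewrite -e; ring.
apply: le_trans (ler_normD _ _) _; rewrite -natr1; lra.
Qed.

Lemma sum_ord_leq_bound N K : (\sum_(t < N.+1) ((0 < t) && (t <= K)) <= K)%N.
Proof.
suff -> : (\sum_(t < N.+1) ((0 < t) && (t <= K)) = minn N K)%N by exact: geq_minr.
elim: N => [|N IH]; first by rewrite big_ord_recr big_ord0 /=; lia.
rewrite big_ord_recr /= IH; lia.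
Qed.

(* If [n / a = n' / a' = s / t] in lowest terms, then [a = t g], [n = s g],
   [a' = t g'], [n' = s g'], so that [t g <= A] and [s g' <= x]. *)
Lemma card_equal_ratios (A x : nat) :
  (#|[set w : ('I_A * 'I_x) * ('I_A * 'I_x) |
      w.1.2.+1 * w.2.1.+1 == w.2.2.+1 * w.1.1.+1]| <=
   \sum_(g < A) \sum_(h < A) (A %/ g.+1) * (x %/ h.+1))%N.
Proof.
set Q := [set w | _].
pose tgt := ('I_A * 'I_A * ('I_A.+1 * 'I_x.+1))%type.
pose Z := [set z : tgt | ((0 < z.2.1) && (z.2.1 <= A %/ z.1.1.+1)) && ((0 < z.2.2) &&
    (z.2.2 <= x %/ z.1.2.+1))]%N.
apply: (@leq_trans #|Z|); last first.
  pose c (N : nat) (g t : nat) : nat := ((0 < t) && (t <= N %/ g.+1))%N.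
  have -> : #|Z| = \sum_(z : tgt) (c A z.1.1 z.2.1 * c x z.1.2 z.2.2)%N.
    rewrite -sum1_card big_mkcond; apply: eq_bigr => z _.
    by rewrite inE mulnb; case: (_ && _).
  rewrite -(pair_bigA _ (fun (z1 : 'I_A * 'I_A) (z2 :
      'I_A.+1 * 'I_x.+1) => c A z1.1 z2.1 * c x z1.2 z2.2)%N) /=.
  rewrite -(pair_bigA _ (fun g h : 'I_A => \sum_(z2 :
      'I_A.+1 * 'I_x.+1) c A g z2.1 * c x h z2.2)%N) /=.
  apply: leq_sum => g _; apply: leq_sum => h _.
  rewrite -(pair_bigA _ (fun (t : 'I_A.+1) (s : 'I_x.+1) => c A g t * c x h s)%N) /=.
  apply: leq_trans (leq_mul (sum_ord_leq_bound A (A %/ g.+1)) (sum_ord_leq_bound x (x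
      %/ h.+1))).
  by rewrite big_distrl /=; apply: leq_sum => t _; rewrite big_distrr.
pose gc (a : 'I_A) (n : 'I_x) := (gcdn a.+1 n.+1).-1.
have gcE a n : (gc a n).+1 = gcdn a.+1 n.+1 by rewrite /gc prednK// gcdn_gt0.
have gcA a n : (gc a n < A)%N.
  by rewrite gcE; apply: leq_trans (ltn_ord a); apply: dvdn_leq => //; exact: dvdn_gcdl.
pose F (w : ('I_A * 'I_x) * ('I_A * 'I_x)) : tgt :=
  ((Ordinal (gcA w.1.1 w.1.2), Ordinal (gcA w.2.1 w.2.2)),
   (inord (w.1.1.+1 %/ (gc w.1.1 w.1.2).+1), inord (w.1.2.+1 %/ (gc w.1.1 w.1.2).+1))).
have tE (a : 'I_A) (n : 'I_x) (a' : 'I_A) (n' : 'I_x) :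
    (n.+1 * a'.+1 = n'.+1 * a.+1)%N ->
  (a'.+1 = a.+1 %/ (gc a n).+1 * (gc a' n').+1 /\ n'.+1 = n.+1 %/ (gc a n).+1 * (gc
      a' n').+1)%N.
  move=> e; rewrite !gcE; set g := gcdn a.+1 n.+1.
  have g0 : (0 < g)%N by rewrite gcdn_gt0.
  have ga : (g %| a.+1)%N := dvdn_gcdl _ _.
  have gn : (g %| n.+1)%N := dvdn_gcdr _ _.
  have h1 : (gcdn a'.+1 n'.+1 * a.+1 = a'.+1 * g)%N.
    by rewrite muln_gcdl -e (mulnC n.+1) -muln_gcdr.
  have h2 : (gcdn a'.+1 n'.+1 * n.+1 = n'.+1 * g)%N.
    by rewrite muln_gcdl (mulnC a'.+1) e -muln_gcdr mulnC.
  by split; apply/eqP; rewrite -(eqn_pmul2r g0) -?h1 -?h2 mulnAC divnK// mulnC.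
have ltt (m k N : nat) : (m <= N)%N -> (m %/ k < N.+1)%N.
  by move=> mN; rewrite ltnS (leq_trans _ mN)// leq_div.
rewrite -(card_in_imset (f := F)).
  apply/subset_leq_card/fintype.subsetP => z /imsetP[w wQ ->{z}].
  move: w wQ => [[a n] [a' n']]; rewrite inE /= => /eqP e.
  have [e1 e2] := tE _ _ _ _ e.
  rewrite inE /= !inordK ?ltt//.
  rewrite !divn_gt0// leq_div2r// leq_divRL// -e2 ltn_ord !gcE.
  by rewrite (dvdn_leq _ (dvdn_gcdl _ _))// (dvdn_leq _ (dvdn_gcdr _ _)).
move=> [[a n] [b m]] [[a' n'] [b' m']]; rewrite !inE /= => /eqP e /eqP e'.
have [e1 e2] := tE _ _ _ _ e; have [e1' e2'] := tE _ _ _ _ e'.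
move=> Fe.
have /= g1 := congr1 (fun z : tgt => nat_of_ord z.1.1) Fe.
have /= g2 := congr1 (fun z : tgt => nat_of_ord z.1.2) Fe.
have := congr1 (fun z : tgt => nat_of_ord z.2.1) Fe; rewrite /= !inordK ?ltt// => t1.
have := congr1 (fun z : tgt => nat_of_ord z.2.2) Fe; rewrite /= !inordK ?ltt// => s1.
have b1 : b.+1 = b'.+1 by rewrite e1 e1' t1 g2.
have m1 : m.+1 = m'.+1 by rewrite e2 e2' s1 g2.
have dv (a0 : 'I_A) (n0 : 'I_x) : (a0.+1 = a0.+1 %/ (gc a0 n0).+1 * (gc a0 n0).+1)%N.
  by rewrite divnK// gcE dvdn_gcdl.
have dv' (a0 : 'I_A) (n0 : 'I_x) : (n0.+1 = n0.+1 %/ (gc a0 n0).+1 * (gc a0 n0).+1)%N.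
  by rewrite divnK// gcE dvdn_gcdr.
have a1 : a.+1 = a'.+1 by rewrite (dv a n) (dv a' n') t1 g1.
have n1 : n.+1 = n'.+1 by rewrite (dv' a n) (dv' a' n') s1 g1.
by congr ((_, _), (_, _)); apply: val_inj; apply: succn_inj.
Qed.

Lemma card_equal_ratios_harmonic (R : realFieldType) (A x : nat) :
  #|[set w : ('I_A * 'I_x) * ('I_A * 'I_x) |
      (w.1.2.+1 * w.2.1.+1 == w.2.2.+1 * w.1.1.+1)%N]|%:R <=
  A%:R * x%:R * (\sum_(g < A) g.+1%:R^-1) ^+ 2 :> R.
Proof.
apply: le_trans (_ : (\sum_(g < A) \sum_(h < A) (A %/ g.+1) * (x %/ h.+1))%N%:R <= _).
  by rewrite ler_nat card_equal_ratios.
have divR N g : (N %/ g.+1)%:R <= N%:R * g.+1%:R^-1 :> R.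
  by rewrite ler_pdivlMr ?ltr0n// -natrM ler_nat leq_divM.
set H := (X in X ^+ 2).
have -> : A%:R * x%:R * H ^+ 2 = (A%:R * H) * (x%:R * H) by ring.
rewrite /H [A%:R * _]mulr_sumr [x%:R * _]mulr_sumr big_distrlr /= natr_sum;
    apply: ler_sum => g _.
rewrite natr_sum; apply: ler_sum => h _.
by rewrite natrM ler_pM ?ler0n.
Qed.

(* Shifting by [ab] and writing [n + ab = a (n/a + b)] reduces the sum to the
   short sums [W u], [u = n/a]; those with [W u <= eta B] are harmless, and the
   others are few by the moment estimate. *)
Lemma burgess_core (R : rcfType) (p x A B r : nat) (eta : R) :
  prime p -> odd p -> (0 < A)%N -> (A < p)%N -> (A * x < p)%N ->
  (0 < B)%N -> (B < p)%N -> 0 < eta ->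
  (16 * r.*2.+1 ^ 2 <= p)%N ->
  let M := (r ^ r.*2 * B ^ r)%:R * p%:R + B%:R ^+ r.*2 * (19 * r.*2.+1%:R * Num.sqrt
      p%:R) in
  exists2 cnt : R, 
    A%:R * `|\sum_(n < x) qchar R (n.+1%:R : 'F_p)| <=
      2 * A%:R ^+ 2 * B%:R + eta * A%:R * x%:R + cnt &
    0 <= cnt /\ cnt ^+ 2 * (eta * B%:R) ^+ r.*2 <=
      A%:R * x%:R * (\sum_(g < A) g.+1%:R^-1) ^+ 2 * M.
Proof.
move=> pp oddp A0 Ap Axp B0 Bp eta0 rp M.
pose chi (n : nat) := qchar R (n.+1%:R : 'F_p).
pose W (u : 'F_p) := \sum_(b < B) qchar R (u + b.+1%:R).
pose bad := [set u : 'F_p | eta * B%:R < `|W u|].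
pose phi (t : 'I_A * 'I_x) : 'F_p := t.2.+1%:R / t.1.+1%:R.
pose nu (u : 'F_p) : R := #|[set t | phi t == u]|%:R.
pose cnt : R := #|[set t | phi t \in bad]|%:R.
have B0R : 0 < B%:R :> R by rewrite ltr0n.
have A0R : 0 < A%:R :> R by rewrite ltr0n.
have an0 (a : 'I_A) : a.+1%:R != 0 :> 'F_p.
  rewrite -(dvdn_pcharf (pchar_Fp pp)) gtnNdvd//; exact: leq_ltn_trans Ap.
exists cnt.
  have WB u : `|W u| <= B%:R.
    apply: le_trans (ler_norm_sum _ _ _) _.
    apply: le_trans (_ : \sum_(b < B) 1 <= _); last by rewrite sumr_const card_ord.
    by apply: ler_sum => b _; exact: normr_qchar_le1.
  pose S := \sum_(n < x) chi n.
  have h1 (a : 'I_A) (b : 'I_B) :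
      `|S - \sum_(n < x) chi (n + a.+1 * b.+1)%N| <= 2 * (A * B)%:R.
    apply: le_trans (@sum_shift_bound R chi x _ (fun n => normr_qchar_le1 _ _)) _.
    by rewrite ler_pM2l// ler_nat leq_mul.
  have h2 (a : 'I_A) : `|\sum_(b < B) \sum_(n < x) chi (n + a.+1 * b.+1)%N| <=
      \sum_(n < x) `|W (phi (a, n))|.
    rewrite exchange_big /=; apply: le_trans (ler_norm_sum _ _ _) _.
    apply: ler_sum => n _; rewrite /W.
    have -> : \sum_(b < B) chi (n + a.+1 * b.+1)%N =
        qchar R (a.+1%:R : 'F_p) * \sum_(b < B) qchar R (phi (a, n) + b.+1%:R).
      rewrite mulr_sumr; apply: eq_bigr => b _; rewrite -qcharM// /chi /phi /=.
      by rewrite mulrDr mulrC divfK// -natrM -natrD addSn.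
    by rewrite normrM ler_piMl// normr_qchar_le1.
  have h3 (a : 'I_A) : B%:R * `|S| <= B%:R * (2 * (A * B)%:R) + \sum_(n < x) `|W (phi
      (a, n))|.
    apply: le_trans (lerD (lexx _) (h2 a)); rewrite -{1}[B%:R]gtr0_norm// -normrM.
    have -> : B%:R * S = \sum_(b < B) (S - \sum_(n < x) chi (n + a.+1 * b.+1)%N)
        + \sum_(b < B) \sum_(n < x) chi (n + a.+1 * b.+1)%N.
      by rewrite -big_split /=; under eq_bigr do rewrite subrK;
          rewrite sumr_const card_ord mulr_natl.
    apply: le_trans (ler_normD _ _) _; rewrite lerD2r.
    apply: le_trans (ler_norm_sum _ _ _) _.
    apply: le_trans (_ : \sum_(b < B) 2 * (A * B)%:R <= _); first exact: ler_sum.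
    by rewrite sumr_const card_ord -[X in X <= _]mulr_natl.
  have h4 : \sum_(a < A) \sum_(n < x) `|W (phi (a,
      n))| <= eta * B%:R * (A%:R * x%:R) + B%:R * cnt.
    rewrite (pair_bigA _ (fun a n => `|W (phi (a, n))|)) /=.
    apply: le_trans (_ : \sum_(t : 'I_A * 'I_x) (eta * B%:R + B%:R * (phi t \in
        bad)%:R) <= _).
      apply: ler_sum => -[a n] _ /=; rewrite inE; case: ltP => [_|le].
        by rewrite mulr1 ler_wpDl ?WB// mulr_ge0// ltW.
      by rewrite mulr0 addr0.
    rewrite big_split /= sumr_const card_prod !card_ord -mulr_sumr -[_ *+ _]mulr_natr
        natrM.
    rewrite lerD2l ler_pM2l// /cnt -sum1_card natr_sum [X in _ <= X]big_mkcond /=.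
    by apply: ler_sum => t _; rewrite [t \in _]inE; case: (phi t \in bad).
  rewrite -(ler_pM2l B0R) -/S.
  have -> : B%:R * (A%:R * `|S|) = \sum_(a < A) B%:R * `|S|.
    by rewrite sumr_const card_ord -[RHS]mulr_natl mulrCA.
  apply: le_trans (ler_sum _ (fun a _ => h3 a)) _.
  rewrite big_split /= sumr_const card_ord -[_ *+ A]mulr_natl.
  apply: le_trans (lerD (lexx _) h4) _; rewrite natrM; lra.
split; first exact: ler0n.
have nuE u : nu u = \sum_t (phi t == u)%:R.
  rewrite /nu -sum1_card natr_sum big_mkcond /=.
  by apply: eq_bigr => t _; rewrite inE; case: (_ == _).
have cE : cnt = \sum_(u in bad) nu u * 1.
  under eq_bigr do rewrite mulr1 nuE.
  rewrite exchange_big /= /cnt -sum1_card natr_sum big_mkcond /=.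
  apply: eq_bigr => t _; rewrite [t \in _]inE; case: ifPn => bt.
    by rewrite (bigD1 (phi t)) //= eqxx big1 ?addr0// => u /andP[_ /negPf];
        rewrite eq_sym => ->.
  by rewrite big1// => u ub; case: eqP => // e; rewrite e ub in bt.
(* Both products are at most A x < p, so a congruence modulo p between them is an equality. *)
have phi_inj t t' : phi t = phi t' -> (t.2.+1 * t'.1.+1 = t'.2.+1 * t.1.+1)%N.
  case: t t' => [a n] [a' n'] /eqP; rewrite /phi /= eqr_div// -!natrM => /eqP.
  by apply: (natr_Fp_inj pp); apply: leq_ltn_trans Axp; rewrite mulnC leq_mul.
have nu2 : \sum_(u : 'F_p) nu u ^+ 2 <= A%:R * x%:R * (\sum_(g < A) g.+1%:R^-1) ^+ 2.
  apply: le_trans (card_equal_ratios_harmonic R A x).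
  apply: le_trans (_ : #|[set w | phi w.1 == phi w.2]|%:R <= _); last first.
    rewrite ler_nat; apply/subset_leq_card/fintype.subsetP => w.
    by rewrite !inE => /eqP /phi_inj ->.
  under eq_bigr do rewrite nuE expr2 big_distrlr /=.
  rewrite exchange_big /= -sum1_card natr_sum [X in _ <= X]big_mkcond /=.
  have -> (X : {set ('I_A * 'I_x) * ('I_A * 'I_x)}) :
      \sum_w (if w \in X then 1 else 0) =
      \sum_t \sum_t' (if (t, t') \in X then 1 else 0) :> R.
    rewrite (pair_bigA _ (fun t t' => if (t, t') \in X then 1 else 0)).
    by apply: eq_bigr => -[t t'].
  apply: ler_sum => t _; rewrite exchange_big /=; apply: ler_sum => t' _.
  rewrite inE /= (bigD1 (phi t)) //= eqxx mul1r big1 ?addr0 => [|u /negPf ne].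
    by rewrite eq_sym; case: (_ == _).
  by rewrite eq_sym ne mul0r.
have badM : #|bad|%:R * (eta * B%:R) ^+ r.*2 <= M.
  apply: le_trans (qchar_sum_moment R pp oddp Bp rp).
  rewrite (bigID (mem bad)) /= -[X in X <= _]addr0; apply: lerD; last first.
    by apply: sumr_ge0 => u _; rewrite exprn_even_ge0// odd_double.
  rewrite mulr_natl -sumr_const; apply: ler_sum => u; rewrite inE => ub.
  have -> : W u ^+ r.*2 = `|W u| ^+ r.*2.
    by rewrite -normrX ger0_norm// exprn_even_ge0// odd_double.
  apply: lerXn2r; rewrite ?nnegrE ?normr_ge0 ?(ltW ub)//.
  by rewrite mulr_ge0// ltW.
(* Cauchy-Schwarz separates the number of equal ratios from the number of bad [u]. *)
have c2 : cnt ^+ 2 <= (\sum_(u : 'F_p) nu u ^+ 2) * #|bad|%:R.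
  rewrite cE; apply: le_trans (sum_Cauchy_Schwarz _ _ _) _.
  under [X in _ * X <= _]eq_bigr do rewrite expr1n.
  rewrite sumr_const ler_wpM2r ?ler0n//.
  rewrite [X in _ <= X](bigID (mem bad)) /= lerDl; apply/sumr_ge0 => u _;
      exact: sqr_ge0.
have e0 : 0 <= (eta * B%:R) ^+ r.*2 by rewrite exprn_even_ge0// odd_double.
apply: le_trans (ler_wpM2r e0 c2) _; rewrite -[X in X <= _]mulrA.
have s0 : 0 <= \sum_(u : 'F_p) nu u ^+ 2 by apply: sumr_ge0 => u _; exact: sqr_ge0.
have b0 : 0 <= #|bad|%:R * (eta * B%:R) ^+ r.*2 by rewrite mulr_ge0 ?ler0n.
exact: ler_pM s0 b0 nu2 badM.
Qed.

(** [expR (c * ln p%:R)] is p^c: powers of p are written in this form up to the final theorem. *)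
Lemma expR_ln_nat_large (R : realType) (K c : R) : 0 < c ->
  exists p0, forall p, (p0 <= p)%N -> K <= expR (c * ln p%:R).
Proof.
move=> c0; pose y := expR (K / c).
exists (Num.truncn y).+1 => p yp.
have yltp : y < p%:R by apply: lt_le_trans (truncnS_gt _) _; rewrite ler_nat.
have : K / c < ln p%:R by rewrite -[X in X < _]expRK ltr_ln// posrE ?expR_gt0//
    (lt_trans (expR_gt0 _) yltp).
rewrite ltr_pdivrMr// mulrC => /ltW h.
by apply: le_trans (expR_ge1Dx _); apply: le_trans h _; rewrite lerDr.
Qed.

Lemma invr_succ_le_lnB (R : realType) (n : nat) : (0 < n)%N ->
  n.+1%:R^-1 <= ln n.+1%:R - ln n%:R :> R.
Proof.
move=> n0; have n0R : 0 < n%:R :> R by rewrite ltr0n.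
have e : 1 + - n.+1%:R^-1 = n%:R / n.+1%:R :> R.
  by rewrite -natr1; field; rewrite natr1 pnatr_eq0.
have := @le_ln1Dx R (- n.+1%:R^-1); rewrite e ln_div ?posrE ?ltr0n// => h.
have /h : -1 < - n.+1%:R^-1 :> R by rewrite ltrN2 invf_lt1 ?ltr0n// ltr1n ltnS.
by rewrite -[X in _ -> is_true X]lerN2 opprB.
Qed.

Lemma harmonic_le_ln (R : realType) (n : nat) : (0 < n)%N ->
  \sum_(g < n) g.+1%:R^-1 <= 1 + ln n%:R :> R.
Proof.
case: n => // n _; elim: n => [|n IH].
  by rewrite big_ord_recr big_ord0 /= add0r invr1 ln1 addr0.
rewrite big_ord_recr /=; have := @invr_succ_le_lnB R n.+1 isT.
move: IH; move: (n.+2%:R^-1) (ln n.+2%:R) (ln n.+1%:R) (\sum_(i < n.+1) _); clear;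
    move=> *; lra.
Qed.

(** B is about p^(1/(2r)), which balances the two terms of the moment, and A is about eta x / (2 B),
    so that the shifts cost at most eta x. Another eta x comes from the harmless short sums. The
    third comes from the bad ones: since A x is at least of order p^(1/2 + delta), a factor
    p^(delta/2) is left after the squared harmonic sum has taken p^(delta/2). *)
Lemma burgess_asymptotic (R : realType) (delta eta : R) :
  0 < delta -> delta <= 1 / 8 -> 0 < eta -> eta <= 1 ->
  exists p0 : nat, forall p, prime p -> (p0 <= p)%N -> forall x : nat,
    expR ((1 / 4 + delta) * ln p%:R) / 2 <= x%:R <= expR ((1 / 4 + delta) * ln p%:R) ->
    `|\sum_(n < x) qchar R (n.+1%:R : 'F_p)| <= 3 * eta * x%:R.
Proof.
move=> d0 d8 eta0 eta1.
pose r := (Num.truncn (1 / delta)).+1.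
have r0 : 0 < r%:R :> R by rewrite ltr0n.
have rd : 1 <= delta * r%:R.
  by rewrite -ler_pdivrMl// mulrC ltW// truncnS_gt.
pose beta : R := 1 / (2 * r%:R).
have b0 : 0 < beta by rewrite divr_gt0 ?mulr_gt0.
have bd : beta <= delta / 2 by rewrite /beta ler_pdivrMr ?mulr_gt0//; lra.
pose K : R := 19 * r.*2.+1%:R.
pose C : R := (r ^ r.*2)%:R + K.
have K0 : 0 < K by rewrite mulr_gt0// ltr0n.
have C0 : 0 < C by rewrite ltr_wpDl ?ler0n.
(* The power of [eta] is 2r from the moment inequality, 2 from the target
   [cnt <= eta * (A%:R * x%:R)], and 1 from the lower bound for A x. *)
pose K2 : R := 32 * (16 / delta ^+ 2) * C / eta ^+ (r.*2 + 3).
have [p1 P1] := @expR_ln_nat_large R (8 / eta) (1 / 4) ltac:(lra).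
have [p2 P2] := @expR_ln_nat_large R K2 (delta / 2) ltac:(lra).
have [p3 P3] := @expR_ln_nat_large R 3 (1 / 2) ltac:(lra).
exists (maxn 3 (maxn (16 * r.*2.+1 ^ 2) (maxn p1 (maxn p2 p3)))) => p pp.
rewrite !geq_max => /and5P[p_3 rp /P1{P1} E1 /P2{P2} E2 /P3{P3} E3] x /andP[x1 x2].
have p0R : 0 < p%:R :> R by rewrite ltr0n prime_gt0.
have oddp : odd p by case: (even_prime pp) p_3 => [->|].
set L := ln p%:R in E1 E2 E3 x1 x2.
pose e a := expR (a * L).
have {}x1 : e (1 / 4 + delta) / 2 <= x%:R := x1.
have {}x2 : x%:R <= e (1 / 4 + delta) := x2.
have {}E1 : 8 / eta <= e (1 / 4) := E1.
have {}E2 : K2 <= e (delta / 2) := E2.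
have {}E3 : 3 <= e (1 / 2) := E3.
have eD a b : e (a + b) = e a * e b by rewrite /e mulrDl expRD.
have e_gt0 a : 0 < e a by exact: expR_gt0.
have L0 : 0 < L by rewrite ln_gt0// ltr1n prime_gt1.
have e_le a b : a <= b -> e a <= e b by move=> ab; rewrite ler_expR ler_pM2r.
have e_lt a b : a < b -> e a < e b by move=> ab; rewrite ltr_expR ltr_pM2r.
have e1 : e 1 = p%:R by rewrite /e mul1r lnK.
have ehalf : e (1/2) * e (1/2) = p%:R by rewrite -eD -e1; congr e; lra.
have sq : Num.sqrt p%:R = e (1/2).
  by rewrite -ehalf -expr2 sqrtr_sqr gtr0_norm.
pose B := (Num.truncn (e beta)).+1.
have B1 : e beta < B%:R by exact: truncnS_gt.
have eb1 : 1 <= e beta by rewrite -(expR0 R) /e ler_expR mulr_ge0// ltW.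
have B2 : B%:R <= 2 * e beta.
  have : (Num.truncn (e beta))%:R <= e beta by rewrite truncn_le ltW.
  rewrite /B -natr1; lra.
have B0 : 0 < B%:R :> R by rewrite ltr0n.
pose A := Num.truncn (eta * x%:R / (2 * B%:R)).
have x0 : 0 < x%:R :> R by apply: lt_le_trans x1; rewrite divr_gt0.
have x3 : x%:R <= e (3/8) by apply: le_trans x2 _; apply: e_le; lra.
set y := eta * x%:R / (2 * B%:R) in A.
have yB : y * (2 * B%:R) = eta * x%:R by rewrite /y divfK// gt_eqF// mulr_gt0.
have y1 : 1 <= y.
  rewrite /y ler_pdivlMr ?mulr_gt0// mul1r.
  have h1 : e (1/4) * e beta <= e (1/4 + delta) by rewrite -eD; apply: e_le; lra.
  have h2 : 8 <= eta * e (1/4) by rewrite mulrC -ler_pdivrMr.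
  have h3 : 8 * e beta <= eta * e (1/4) * e beta by rewrite ler_pM2r.
  have h4 : eta * (e (1/4) * e beta) <= eta * e (1/4 + delta) by rewrite ler_pM2l.
  have h5 : eta * (e (1/4 + delta) / 2) <= eta * x%:R by rewrite ler_pM2l.
  lra.
have A1 : A%:R <= y by rewrite truncn_le; lra.
have A2 : y / 2 <= A%:R.
  have : y < A.+1%:R := truncnS_gt _.
  have : 1 <= A%:R :> R by rewrite ler1n truncn_gt0.
  rewrite -natr1; lra.
have A0 : 0 < A%:R :> R by lra.
have Ax : A%:R <= x%:R :> R.
  apply: le_trans A1 _; rewrite /y ler_pdivrMr ?mulr_gt0//.
  have B1' : 1 <= B%:R :> R by lra.
  have h1 : x%:R * 1 <= x%:R * B%:R :> R by rewrite ler_pM2l.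
  have h2 : eta * x%:R <= 1 * x%:R by rewrite ler_pM2r.
  lra.
have e38 : e (3/8) < e 1 by apply: e_lt; lra.
have Ap : (A < p)%N by rewrite -(ltr_nat R) -e1; lra.
have Axp : (A * x < p)%N.
  rewrite -(ltr_nat R) natrM -e1.
  apply: (@le_lt_trans _ _ (e (3/8) * e (3/8))); first by apply: ler_pM;
      rewrite ?ler0n//; lra.
  by rewrite -eD; apply: e_lt; lra.
have Bp : (B < p)%N.
  rewrite -(ltr_nat R); apply: le_lt_trans B2 _; rewrite -ehalf.
  have h1 : e beta <= e (1/2) by apply: e_le; lra.
  have h2 : 3 * e (1/2) <= e (1/2) * e (1/2) by rewrite ler_pM2r.
  have := e_gt0 (1/2); lra.
have A0n : (0 < A)%N by rewrite -(ltr_nat R).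
have B0n : (0 < B)%N by [].
have [cnt S1 [c0 c1]] := @burgess_core R p x A B r eta pp oddp A0n Ap Axp B0n Bp eta0
    rp.
set H := \sum_(g < A) _ in c1.
have H0 : 0 <= H by apply: sumr_ge0 => g _; rewrite invr_ge0 ler0n.
have H1 : H <= 4 / delta * e (delta / 4).
  apply: le_trans (harmonic_le_ln _ A0n) _.
  have lnA : ln A%:R <= L by rewrite ler_ln ?posrE// ler_nat ltnW.
  (* The inequality 1 + u <= e^u absorbs the logarithm in p^(delta/4). *)
  have h1 := expR_ge1Dx (delta / 4 * L).
  have h2 : 4 / delta * (1 + delta / 4 * L) <= 4 / delta * e (delta / 4)
    by rewrite ler_pM2l// divr_gt0.
  have h3 : 4 / delta * (1 + delta / 4 * L) = 4 / delta + L by field; rewrite gt_eqF.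
  have h4 : 1 <= 4 / delta by rewrite ler_pdivlMr//; lra.
  lra.
have H2 : H ^+ 2 <= 16 / delta ^+ 2 * e (delta / 2).
  apply: (@le_trans _ _ ((4 / delta * e (delta / 4)) ^+ 2)).
    by rewrite lerXn2r ?nnegrE// mulr_ge0 ?divr_ge0 ?ltW.
  rewrite exprMn expr_div_n [e _ ^+ 2]expr2 -eD (_ :
      delta / 4 + delta / 4 = delta / 2); last lra.
  by rewrite expr2 -natrM.
pose M : R := (r ^ r.*2 * B ^ r)%:R * p%:R + B%:R ^+ r.*2 * (19 * r.*2.+1%:R *
    Num.sqrt p%:R).
have {}c1 : cnt ^+ 2 * (eta * B%:R) ^+ r.*2 <= A%:R * x%:R * H ^+ 2 * M := c1.
pose Bp2 := B%:R ^+ r.*2 : R.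
have Bp20 : 0 < Bp2 by exact: exprn_gt0.
have MB : M <= Bp2 * e (1/2) * C.
  rewrite /M /C [X in _ <= X]mulrDr; apply: lerD;
      last by rewrite sq /Bp2 /K le_eqVlt; apply/orP; left; apply/eqP; ring.
  rewrite natrM -ehalf -/Bp2.
  have h1 : e (1/2) <= B%:R ^+ r.
    apply: (@le_trans _ _ (e beta ^+ r)); last by rewrite lerXn2r ?nnegrE ?ler0n// ltW.
    rewrite /e -expRM_natr le_eqVlt; apply/orP; left; apply/eqP; congr expR.
    by rewrite /beta; field; rewrite gt_eqF.
  have h2 : (B ^ r)%:R * (e (1/2) * e (1/2)) <= Bp2 * e (1/2).
    rewrite natrX mulrA ler_pM2r// /Bp2 -addnn exprD ler_pM2l//; exact: exprn_gt0.
  rewrite -mulrA [X in _ <= X]mulrC ler_wpM2l ?ler0n//.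
have Ax0 : 0 < A%:R * x%:R :> R by rewrite mulr_gt0.
have Axlow : eta / 32 * e (1/2 + delta) <= A%:R * x%:R.
  have h1 : eta * x%:R <= 8 * A%:R * e beta.
    have h11 : y * (2 * B%:R) <= (2 * A%:R) * (4 * e beta).
      by apply: ler_pM; [lra|rewrite mulr_ge0|lra|lra].
    lra.
  have h2 : eta * x%:R * x%:R <= 8 * A%:R * e beta * x%:R by rewrite ler_pM2r.
  have h3 : e (1/4 + delta) / 2 * (e (1/4 + delta) / 2) <= x%:R * x%:R.
    by apply: ler_pM; rewrite ?divr_ge0// ltW.
  have h4 : e (1/2 + delta) * e beta <= e (1/4 + delta) * e (1/4 + delta).
    by rewrite -!eD; apply: e_le; lra.
  have h5 : eta * (e (1/4 + delta) / 2 * (e (1/4 + delta) / 2)) <= eta * (x%:R *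
      x%:R) by rewrite ler_pM2l.
  have h6 : eta * (e (1/2 + delta) * e beta) <= eta * (e (1/4 + delta) * e (1/4 +
      delta)) by rewrite ler_pM2l.
  rewrite -(ler_pM2r (e_gt0 beta)); lra.
have cle : cnt <= eta * (A%:R * x%:R).
  rewrite -(ler_pXn2r (n := 2)) ?nnegrE//; last by rewrite mulr_ge0 ?ltW.
  have er0 : 0 < eta ^+ r.*2 by exact: exprn_gt0.
  have d1 : cnt ^+ 2 * eta ^+ r.*2 * Bp2 <= A%:R * x%:R * (16 / delta ^+ 2 * e (delta
      / 2)) * (e (1/2) * C) * Bp2.
    rewrite -mulrA -exprMn; apply: le_trans c1 _.
    have M0 : 0 <= M.
      by rewrite /M -natrX addr_ge0// !mulr_ge0 ?sqrtr_ge0 ?ler0n.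
    have hm : H ^+ 2 * M <= (16 / delta ^+ 2 * e (delta / 2)) * (Bp2 * e (1/2) * C).
      by apply: ler_pM; rewrite ?exprn_ge0.
    have hm' : A%:R * x%:R * (H ^+ 2 * M) <= A%:R * x%:R * (16 / delta ^+ 2 * e
        (delta / 2) * (Bp2 * e (1/2) * C)) by rewrite ler_pM2l.
    rewrite -[X in X <= _]mulrA; apply: le_trans hm' _.
    rewrite le_eqVlt; apply/orP; left; apply/eqP; move: (16 / _) => q; ring.
  rewrite ler_pM2r// in d1.
  have K2E : 16 / delta ^+ 2 * C = K2 * eta ^+ 3 / 32 * eta ^+ r.*2.
    rewrite /K2 exprD; field; rewrite !expf_neq0 ?gt_eqF//.
  have d2 : cnt ^+ 2 <= A%:R * x%:R * (e (delta / 2) * e (1/2)) * (K2 * eta ^+ 3 / 32).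
    rewrite -(ler_pM2r er0); apply: le_trans d1 _.
    rewrite le_eqVlt; apply/orP; left; apply/eqP; rewrite -[RHS]mulrA -K2E; ring.
  have d3 : K2 * (eta ^+ 3 / 32 * (A%:R * x%:R * (e (delta / 2) * e (1/2)))) <=
            e (delta / 2) * (eta ^+ 3 / 32 * (A%:R * x%:R * (e (delta / 2) * e (1/2)))).
    by rewrite ler_wpM2r// !mulr_ge0 ?divr_ge0 ?exprn_ge0 ?ltW.
  have d4 : eta ^+ 2 * (A%:R * x%:R) * (eta / 32 * e (1/2 + delta)) <= eta ^+ 2 *
      (A%:R * x%:R) * (A%:R * x%:R).
    by rewrite ler_wpM2l// mulr_ge0 ?exprn_ge0 ?ltW.
  have d5 : e (1 / 2 + delta) = e (delta/2) * (e (delta/2) * e (1/2))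
    by rewrite -!eD; congr e; lra.
  rewrite d5 in d4; lra.
rewrite -(ler_pM2l A0).
have f1 : A%:R * (A%:R * (2 * B%:R)) <= A%:R * (eta * x%:R).
  by rewrite ler_pM2l// -yB ler_pM2r// mulr_gt0.
lra.
Qed.

(** * Mertens' theorems *)

Lemma ln_natE (R : realType) (n : nat) : (0 < n)%N ->
  ln n%:R = \sum_(0 <= q < n.+1 | prime q) (logn q n)%:R * ln q%:R :> R.
Proof.
move=> n0; rewrite -{1}(partnT n0) /partn.
have H (s : seq nat) : ln (\prod_(q <- s | q \in predT) q ^ logn q n)%N%:R =
    \sum_(q <- s | prime q) (logn q n)%:R * ln q%:R :> R.
  elim: s => [|q s IH]; first by rewrite !big_nil ln1.
  rewrite !big_cons inE /=; case: ifP => pq.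
    have q0 := prime_gt0 pq.
    rewrite natrM lnM ?posrE ?ltr0n ?expn_gt0 ?q0 ?IH //; last first.
      by apply: prodn_gt0 => i; rewrite lognE;
          case: ifP => [/and3P[/prime_gt0 i0 _ _]|]; rewrite ?expn0// expn_gt0 i0.
    by rewrite natrX lnXn ?ltr0n// mulr_natl.
  by rewrite lognE pq /= expn0 mul1n.
exact: H.
Qed.

Lemma ln_nat_smooth (R : realType) (n b : nat) : (0 < n)%N ->
  (forall q, prime q -> (q %| n)%N -> (q <= b)%N) ->
  ln n%:R = \sum_(0 <= q < b.+1 | prime q) (logn q n)%:R * ln q%:R :> R.
Proof.
move=> n0 sm; rewrite ln_natE//; pose N := maxn n b.
have tail c : (c <= N)%N -> (forall q, prime q -> (q %| n)%N -> (q <= c)%N) ->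
    \sum_(0 <= q < N.+1 | prime q) (logn q n)%:R * ln q%:R =
    \sum_(0 <= q < c.+1 | prime q) (logn q n)%:R * ln q%:R :> R.
  move=> cN smc; rewrite (@big_cat_nat _ _ _ c.+1)//= [X in _ + X]big_nat_cond.
  rewrite [X in _ + X]big1 ?addr0// => q /andP[/andP[cq _] pq].
  rewrite lognE pq n0 /=; case: ifP => [/(smc _ pq)|_]; last by rewrite mul0r.
  by rewrite leqNgt cq.
rewrite -(tail n) ?leq_maxl//; last by move=> q _; exact: dvdn_leq.
by rewrite (tail b) ?leq_maxr.
Qed.

Lemma ln_factE (R : realType) (n : nat) :
  ln n`!%:R = \sum_(0 <= q < n.+1 | prime q) (logn q n`!)%:R * ln q%:R :> R.
Proof.
apply: ln_nat_smooth; first exact: fact_gt0.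
by move=> q pq; apply: contraTT; rewrite -ltnNge; exact: prime_ndvd_fact.
Qed.

Lemma logn_fact_lower (q n : nat) : prime q -> (n %/ q <= logn q n`!)%N.
Proof.
move=> pq; rewrite logn_fact//; case: n => [|n]; first by rewrite div0n.
by rewrite big_ltn// expn1 leq_addr.
Qed.

Lemma logn_fact_upper (q n : nat) : prime q -> (logn q n`! * q.-1 <= n)%N.
Proof.
move=> pq; rewrite logn_fact//.
(* The geometric series in integers: the remainder n / q^K carries the induction. *)
suff H K : ((\sum_(1 <= k < K.+1) n %/ q ^ k) * q.-1 + n %/ q ^ K <= n)%N.
  by apply: leq_trans (H n); rewrite leq_addr.
elim: K => [|K IH]; first by rewrite big_geq// mul0n expn0 divn1.
apply: leq_trans IH; rewrite big_nat_recr//= mulnDl -addnA leq_add2l.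
rewrite -mulnSr prednK ?prime_gt0// expnSr divnMA; exact: leq_divM.
Qed.

(** Chebyshev's argument: the primes in (m, 2m] all divide the central binomial coefficient, which
    is at most 4^m. *)
Lemma sum_ln_primes_interval (R : realType) (m : nat) :
  \sum_(m.+1 <= q < m.*2.+1 | prime q) ln q%:R <= 2 * m%:R :> R.
Proof.
have C0 : (0 < 'C(m.*2, m))%N by rewrite bin_gt0 -addnn leq_addr.
have Cle : ('C(m.*2, m) <= 2 ^ m.*2)%N.
  rewrite -[2%N]/((1 + 1)%N) expnDn (bigD1 (inord m)) //= inordK;
      last by rewrite ltnS -addnn leq_addr.
  by rewrite !exp1n !muln1 leq_addr.
apply: (@le_trans _ _ (ln 'C(m.*2, m)%:R)); last first.
  apply: (@le_trans _ _ (ln (2 ^ m.*2)%:R)).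
    by rewrite ler_ln ?posrE ?ltr0n ?expn_gt0// ler_nat.
  rewrite natrX lnXn ?ltr0n// -[_ *+ m.*2]mulr_natr -[m.*2]muln2 natrM.
  have h : ln 2 <= 1 :> R by have := @le_ln1Dx R 1 ltac:(lra).
  have : 0 <= m%:R :> R by rewrite ler0n.
  have : ln 2 * (m%:R * 2) <= 1 * (m%:R * 2) :> R by rewrite ler_wpM2r// mulr_ge0.
  lra.
rewrite (@ln_nat_smooth R _ m.*2)//; last first.
  move=> q pq dq; have /(dvdn_trans dq) : ('C(m.*2, m) %| (m.*2)`!)%N.
    by rewrite -(@bin_fact m.*2 m) ?dvdn_mulr// -addnn leq_addr.
  by apply: contraTT; rewrite -ltnNge; exact: prime_ndvd_fact.
rewrite [X in _ <= X](@big_cat_nat _ _ _ m.+1)//=; last by rewrite ltnS -addnn leq_addr.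
rewrite ler_wpDl//.
  by apply: sumr_ge0 => q pq; rewrite mulr_ge0 ?ler0n// ln_ge0// ler1n prime_gt0.
rewrite big_nat_cond [X in _ <= X]big_nat_cond;
    apply: ler_sum => q /andP[/andP[mq q2m] pq].
rewrite ler_peMl//; first by rewrite ln_ge0// ler1n prime_gt0.
rewrite ler1n lognE pq C0 /=.
have : (q %| 'C(m.*2, m) * (m`! * (m.*2 - m)`!))%N.
  by rewrite bin_fact ?dvdn_fact ?prime_gt0// -addnn leq_addr.
by rewrite -addnn addnK !Euclid_dvdM// !(negPf (prime_ndvd_fact pq mq)) !orbF => ->.
Qed.

Lemma chebyshev_theta (R : realType) (n : nat) :
  \sum_(0 <= q < n.+1 | prime q) ln q%:R <= 6 * n%:R :> R.
Proof.
elim/ltn_ind: n => n IH.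
have [n1|n2] := leqP n 1.
  rewrite big_nat_cond big1 ?mulr_ge0// => q /andP[/andP[_ qn] pq].
  by have := prime_gt1 pq; rewrite ltnNge (leq_trans (ltnSE qn)).
(* The constant 6 closes the induction: 6 m + 2 m <= 4 (n + 1) <= 6 n for n >= 2. *)
pose m := uphalf n.
have mn : (m < n)%N by rewrite /m; lia.
have nm : (n <= m.*2)%N by rewrite /m; lia.
have m2 : (m.*2 <= n.+1)%N by rewrite /m; lia.
have := IH _ mn; have := sum_ln_primes_interval R m.
rewrite (@big_cat_nat _ _ _ m.+1 0 n.+1)//= ?ltnS ?(ltnW mn)//.
have h1 : \sum_(m.+1 <= q < n.+1 | prime q) ln q%:R <= \sum_(m.+1 <= q < m.*2.+1 |
    prime q) ln q%:R :> R.
  rewrite [X in _ <= X](@big_cat_nat _ _ _ n.+1)//= ?ltnS ?(ltnW mn)//.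
  by rewrite lerDl; apply: sumr_ge0 => q pq; rewrite ln_ge0// ler1n prime_gt0.
have : m%:R * 2 <= n%:R + 1 :> R
  by rewrite -(natrM _ m 2) -(natrD _ n 1) ler_nat muln2 addn1.
have : 2 <= n%:R :> R by rewrite (ler_nat R 2).
lra.
Qed.

Lemma lnB_le_inv (R : realType) (n : nat) : (0 < n)%N ->
  ln n.+1%:R - ln n%:R <= n%:R^-1 :> R.
Proof.
move=> n0; have n0R : 0 < n%:R :> R by rewrite ltr0n.
rewrite -ln_div ?posrE ?ltr0n//.
have -> : n.+1%:R / n%:R = 1 + n%:R^-1 :> R by rewrite -natr1; field; rewrite gt_eqF.
by apply: le_ln1Dx; apply: lt_trans (_ : 0 < _); rewrite ?oppr_lt0 ?invr_gt0.
Qed.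

Lemma ln_fact_bounds (R : realType) (n : nat) :
  n%:R * ln n%:R - n%:R <= ln (n`!%:R : R) <= n%:R * ln n%:R.
Proof.
elim: n => [|n /andP[lo hi]]; first by rewrite !mul0r subrr fact0 ln1 lexx.
rewrite factS natrM lnM ?posrE ?ltr0n ?fact_gt0//.
case: n lo hi => [|n] lo hi; first by rewrite fact0 !ln1 mulr0 addr0 sub0r lexx andbT
    oppr_le0.
have n0 : 0 < n.+1%:R :> R by rewrite ltr0n.
have h1 : ln n.+1%:R <= ln n.+2%:R :> R by rewrite ler_ln ?posrE ?ltr0n// ler_nat.
have h2 : n.+1%:R * (ln n.+2%:R - ln n.+1%:R) <= n.+1%:R * n.+1%:R^-1 :> R.
  by rewrite ler_pM2l// lnB_le_inv.
have h3 : n.+1%:R * ln n.+1%:R <= n.+1%:R * ln n.+2%:R :> R by rewrite ler_pM2l.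
have bE : n.+2%:R = n.+1%:R + 1 :> R by rewrite natr1.
rewrite divff ?gt_eqF// in h2.
move: bE h1 h2 h3 lo hi n0; move:
    (n.+1%:R) (n.+2%:R) (ln n.+2%:R) (ln n.+1%:R) (ln (n.+1)`!%:R).
move=> a b lb la c ->.
by move=> *; apply/andP; split; lra.
Qed.

(** Already the sum over all integers telescopes: the term at k + 1 is at most [f k - f k.+1], and
    [f 1] is 2. *)
Lemma sum_ln_primes_inv_pred (R : realType) (n : nat) :
  \sum_(0 <= q < n.+1 | prime q) ln q%:R / (q%:R * (q%:R - 1)) <= 2 :> R.
Proof.
pose f (k : nat) : R := (ln k%:R + 2) / k%:R.
have f0 k : (0 < k)%N -> 0 <= f k
  by move=> k0; rewrite divr_ge0 ?addr_ge0 ?ln_ge0 ?ler1n.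
case: n => [|n].
  by rewrite big_mkcond big_nat_recr//= big_geq// addr0.
suff H : \sum_(0 <= q < n.+2 | prime q) ln q%:R / (q%:R * (q%:R - 1)) <= 2 - f n.+1.
  by apply: le_trans H _; have := f0 n.+1 isT; lra.
elim: n => [|n IH].
  by rewrite /f ln1 big_mkcond !big_nat_recr//= big_geq// !addr0 add0r invr1 mulr1
      subrr.
rewrite big_mkcond big_nat_recr//= -big_mkcond /=.
have a0 : 0 < n.+1%:R :> R by rewrite ltr0n.
have b0 : 0 < n.+2%:R :> R by rewrite ltr0n.
have h0 : 0 <= ln n.+2%:R :> R by rewrite ln_ge0// ler1n.
have h : ln n.+2%:R / (n.+2%:R * (n.+2%:R - 1)) <= f n.+1 - f n.+2.
  have bE : n.+2%:R = n.+1%:R + 1 :> R by rewrite natr1.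
  have lb : n.+1%:R * (ln n.+2%:R - ln n.+1%:R) <= 1 :> R.
    by rewrite mulrC -ler_pdivlMr// mul1r lnB_le_inv.
  have lc : ln n.+2%:R - ln n.+1%:R <= 1 :> R.
    by apply: le_trans (lnB_le_inv _ (isT : (0 < n.+1)%N)) _; rewrite invf_le1// ler1n.
  rewrite /f; move: bE lb lc a0 b0; move: (n.+1%:R) (n.+2%:R) (ln n.+1%:R) (ln n.+2%:R).
  move=> a b la lb0 -> lb lc a0 b0.
  have -> : lb0 / ((a + 1) * (a + 1 - 1)) = lb0 / ((a + 1) * a) by rewrite addrK.
  have -> : (la + 2) / a - (lb0 + 2) / (a + 1) = ((la + 2) * (a + 1) - (lb0 + 2) * a)
      / ((a + 1) * a).
    by field; rewrite !gt_eqF.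
  rewrite ler_pM2r ?invr_gt0 ?mulr_gt0//; lra.
case: ifP => _; last first.
  rewrite addr0; apply: le_trans IH _.
  suff : 0 <= ln n.+2%:R / (n.+2%:R * (n.+2%:R - 1)) :> R.
    by move: h; move: (_ / _) (f _) (f _) => *; lra.
  by rewrite divr_ge0// mulr_ge0 ?ler0n// subr_ge0 ler1n.
by move: IH h; rewrite /=; move:
    (\sum_(0 <= i < n.+2 | _) _) (_ / _) (f _) (f _) => *; lra.
Qed.

Definition mertens_sum (R : realType) (n : nat) : R :=
  \sum_(0 <= q < n.+1 | prime q) ln q%:R / q%:R.

(** Legendre's formula compares log n! with n times the sum. Rounding down costs the Chebyshev sum,
    at most 6 n, on one side; higher prime powers cost 2 n on the other, where Stirling's estimate
    costs another n. *)
Lemma mertens_first (R : realType) (n : nat) : (0 < n)%N ->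
  `|mertens_sum R n - ln n%:R| <= 6.
Proof.
move=> n0; have n0R : 0 < n%:R :> R by rewrite ltr0n.
have /andP[flo fhi] := ln_fact_bounds R n.
have lnq q : prime q -> 0 <= ln q%:R :> R
  by move=> pq; rewrite ln_ge0// ler1n prime_gt0.
have up : n%:R * mertens_sum R n - \sum_(0 <= q < n.+1 | prime q) ln q%:R <= ln n`!%:R.
  rewrite ln_factE /mertens_sum mulr_sumr -sumrB; apply: ler_sum => q pq.
  have q0 : 0 < q%:R :> R by rewrite ltr0n prime_gt0.
  have h : n%:R / q%:R - 1 <= (logn q n`!)%:R :> R.
    apply: (@le_trans _ _ (n %/ q)%:R); last by rewrite ler_nat logn_fact_lower.
    rewrite lerBlDr ler_pdivrMr// natr1 -natrM ler_nat ltnW// -ltn_divLR ?prime_gt0//.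
  have := ler_wpM2r (lnq q pq) h; congr (_ <= _); field; rewrite gt_eqF//.
have lo : ln n`!%:R <= n%:R * mertens_sum R n + n%:R * 2.
  apply: le_trans (lerD (lexx _) (ler_wpM2l (ltW n0R) (sum_ln_primes_inv_pred R n))).
  rewrite ln_factE /mertens_sum !mulr_sumr -big_split /=; apply: ler_sum => q pq.
  have q0 : 0 < q%:R :> R by rewrite ltr0n prime_gt0.
  have q1 : 0 < q%:R - 1 :> R by rewrite subr_gt0 ltr1n prime_gt1.
  have h : (logn q n`!)%:R <= n%:R / (q%:R - 1) :> R.
    rewrite ler_pdivlMr// -[q in q%:R - 1](prednK (prime_gt0 pq)) -natr1 addrK -natrM
        ler_nat.
    exact: logn_fact_upper.
  have := ler_wpM2r (lnq q pq) h; congr (_ <= _); field; rewrite !gt_eqF//.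
have th := chebyshev_theta R n.
rewrite ler_norml; apply/andP; split; rewrite -(ler_pM2l n0R); lra.
Qed.

Definition prime_recip (R : realType) (n : nat) : R :=
  \sum_(0 <= q < n.+1 | prime q) q%:R^-1.

Lemma prime_recipB (R : realType) (m n : nat) : (m <= n)%N ->
  prime_recip R n - prime_recip R m = \sum_(m.+1 <= q < n.+1 | prime q) q%:R^-1.
Proof.
move=> mn; by rewrite /prime_recip (@big_cat_nat _ _ _ m.+1 0 n.+1)//= addrAC subrr
    add0r.
Qed.

Lemma mertens_sumB (R : realType) (m n : nat) : (m <= n)%N ->
  mertens_sum R n - mertens_sum R m = \sum_(m.+1 <= q < n.+1 | prime q) ln q%:R / q%:R.
Proof.
move=> mn; by rewrite /mertens_sum (@big_cat_nat _ _ _ m.+1 0 n.+1)//= addrAC subrr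
    add0r.
Qed.

Lemma mertens_sum_expR (R : realType) (v : R) : 0 <= v ->
  `|mertens_sum R (Num.truncn (expR v)) - v| <= 7.
Proof.
move=> v0; set n := Num.truncn _.
have e1 : 1 <= expR v by rewrite -(expR0 R) ler_expR.
have n0 : (0 < n)%N by rewrite truncn_gt0.
have n0R : 0 < n%:R :> R by rewrite ltr0n.
have n1 : n%:R <= expR v by rewrite truncn_le expR_ge0.
have n2 : expR v <= 2 * n%:R.
  have : expR v < n.+1%:R := truncnS_gt _.
  have : 1 <= n%:R :> R by rewrite ler1n.
  rewrite -natr1; lra.
have l1 : ln n%:R <= v by rewrite -[X in _ <= X]expRK ler_ln ?posrE ?expR_gt0.
have l2 : v <= ln 2 + ln n%:R.
  by rewrite -lnM ?posrE// -[X in X <= _]expRK ler_ln ?posrE ?expR_gt0 ?mulr_gt0.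
have l3 : ln 2 <= 1 :> R by have := @le_ln1Dx R 1 ltac:(lra).
have := @mertens_first R n n0; rewrite !ler_norml => /andP[h1 h2].
by apply/andP; split; lra.
Qed.

(** On the scale v = log x, Mertens' second theorem says that this is log v plus a constant plus
    o(1). *)
Definition prime_recip_exp (R : realType) (v : R) : R :=
  prime_recip R (Num.truncn (expR v)).

Lemma truncn_expR_le (R : realType) (v w : R) : v <= w ->
  (Num.truncn (expR v) <= Num.truncn (expR w))%N.
Proof. by move=> vw; apply: le_truncn; rewrite ler_expR. Qed.

(** For primes between e^v and e^w, log q lies between v and w, so 1/q is compared with (log q) / q.
    The constant 14 is twice the error in [mertens_sum_expR]. *)
Lemma prime_recip_exp_block (R : realType) (v w : R) : 0 < v -> v <= w ->
  (w - v - 14) / w <= prime_recip_exp w - prime_recip_exp v <= (w - v + 14) / v.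
Proof.
move=> v0 vw; have w0 : 0 < w by exact: lt_le_trans vw.
have mn := truncn_expR_le vw.
rewrite /prime_recip_exp prime_recipB//.
have := mertens_sum_expR (ltW v0); have := mertens_sum_expR (ltW w0).
have := mertens_sumB R mn.
set m := Num.truncn (expR v) in mn *; set n := Num.truncn (expR w) in mn *.
rewrite !ler_norml => hB /andP[h1 h2] /andP[h3 h4].
have lnv q : (m < q)%N -> v <= ln q%:R.
  move=> mq; have q0 : 0 < q%:R :> R by rewrite ltr0n; lia.
  rewrite -[X in X <= _]expRK ler_ln ?posrE ?expR_gt0// ltW//.
  by apply: lt_le_trans (truncnS_gt _) _; rewrite ler_nat.
have lnw q : prime q -> (q <= n)%N -> ln q%:R <= w.
  move=> pq qn; rewrite -[X in _ <= X]expRK ler_ln ?posrE ?expR_gt0 ?ltr0n ?prime_gt0//.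
  by apply: le_trans (_ : n%:R <= _); rewrite ?ler_nat// truncn_le expR_ge0.
apply/andP; split.
  apply: (@le_trans _ _ ((mertens_sum R n - mertens_sum R m) / w)).
    by rewrite ler_pM2r ?invr_gt0//; lra.
  rewrite hB mulr_suml big_nat_cond [X in _ <= X]big_nat_cond.
  apply: ler_sum => q /andP[/andP[mq qn] pq].
  by rewrite mulrAC ler_piMl ?invr_ge0 ?ler0n// ler_pdivrMr// mul1r lnw.
apply: (@le_trans _ _ ((mertens_sum R n - mertens_sum R m) / v)); last first.
  by rewrite ler_pM2r ?invr_gt0//; lra.
rewrite hB mulr_suml big_nat_cond [X in _ <= X]big_nat_cond.
apply: ler_sum => q /andP[/andP[mq qn] pq].
by rewrite mulrAC ler_peMl ?invr_ge0 ?ler0n// ler_pdivlMr// mul1r lnv.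
Qed.

Lemma prime_recip_unbounded (R : realType) (L : R) : exists n, L <= prime_recip R n.
Proof.
(* Doubling v adds at least 1/2 - 7/v, hence at least 1/4 since v >= 56. *)
have H k : k%:R / 4 <= prime_recip_exp (56 * 2 ^+ k) :> R.
  elim: k => [|k IH].
    by rewrite mul0r; apply: sumr_ge0 => q _; rewrite invr_ge0 ler0n.
  have p0 : 0 < 2 ^+ k :> R by rewrite exprn_gt0.
  have p1 : 1 <= 2 ^+ k :> R by rewrite exprn_ege1// ler1n.
  have v0 : 0 < 56 * 2 ^+ k :> R by rewrite mulr_gt0.
  have vw : 56 * 2 ^+ k <= 56 * 2 ^+ k.+1 :> R by rewrite exprS; lra.
  have /andP[h _] := prime_recip_exp_block v0 vw.
  have h2 : 1 / 4 <= (56 * 2 ^+ k.+1 - 56 * 2 ^+ k - 14) / (56 * 2 ^+ k.+1) :> R.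
    by rewrite ler_pdivlMr; rewrite exprS; lra.
  rewrite -natr1; lra.
exists (Num.truncn (expR (56 * 2 ^+ (Num.truncn (4 * L)).+1 : R))).
apply: le_trans (H _); have := truncnS_gt (4 * L); lra.
Qed.

(** Instead of partial summation, the range from v to e^t v is cut into M blocks of ratio e^h with h
    = t / M. Each block contributes at most e^h - 1 + 14 / v, hence at most h + 2 h^2 + 14 / v. *)
Lemma prime_recip_exp_ratio (R : realType) (t kappa : R) : 0 < t -> 0 < kappa ->
  exists2 V : R, 0 < V & forall v, V <= v ->
    prime_recip_exp (expR t * v) - prime_recip_exp v <= t + kappa.
Proof.
move=> t0 k0.
(* The term 2 t gives h <= 1/2; the other makes the M errors 2 h^2 add up to at most kappa / 2. The
   remaining kappa / 2 is obtained from v being large compared with M. *)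
pose M := (Num.truncn (2 * t + 4 * t ^+ 2 / kappa)).+1.
have M0 : 0 < M%:R :> R by rewrite ltr0n.
have tk : 0 <= 4 * t ^+ 2 / kappa by rewrite divr_ge0 ?mulr_ge0 ?sqr_ge0 ?ltW.
have M1 : 2 * t + 4 * t ^+ 2 / kappa < M%:R by exact: truncnS_gt.
pose h := t / M%:R.
have h0 : 0 < h by rewrite divr_gt0.
have hM : h * M%:R = t by rewrite divfK// gt_eqF.
have h2 : h <= 1 / 2 by rewrite ler_pdivrMr//; lra.
have eh : expR h <= 1 + h + 2 * h ^+ 2.
  have e1 := expR_ge1Dx (- h).
  have e2 : expR h * expR (- h) = 1 by rewrite -expRD subrr expR0.
  have e0 : 0 < expR h := expR_gt0 _.
  have e3 : expR h * (1 + - h) <= 1 by rewrite -[X in _ <= X]e2 ler_pM2l.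
  rewrite -(ler_pM2r (_ : 0 < 1 - h)); last lra.
  apply: le_trans e3 _; have : 0 <= h ^+ 2 * (1 - 2 * h)
    by rewrite mulr_ge0 ?sqr_ge0//; lra.
  lra.
exists (28 * M%:R / kappa); first by rewrite divr_gt0 ?mulr_gt0.
move=> v Vv; have v0 : 0 < v by apply: lt_le_trans Vv; rewrite divr_gt0 ?mulr_gt0.
have {}Vv : 28 * M%:R <= kappa * v by rewrite [kappa * v]mulrC -ler_pdivrMr.
have H k : prime_recip_exp (expR h ^+ k * v) - prime_recip_exp v <= k%:R * (h + 2 * h
    ^+ 2 + 14 / v).
  elim: k => [|k IH]; first by rewrite expr0 mul1r subrr mul0r.
  have e1 : 1 <= expR h by rewrite -(expR0 R) ler_expR ltW.
  have p1 : 1 <= expR h ^+ k by rewrite exprn_ege1.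
  set w := expR h ^+ k * v in IH.
  have w0 : 0 < w by rewrite mulr_gt0// exprn_gt0// expR_gt0.
  have wv : v <= w by rewrite ler_peMl ?(ltW v0).
  have ww : w <= expR h * w by rewrite ler_peMl ?(ltW w0).
  have /andP[_ b] := prime_recip_exp_block w0 ww.
  have b2 : (expR h * w - w + 14) / w <= h + 2 * h ^+ 2 + 14 / v.
    rewrite mulrDl; apply: lerD; last by rewrite ler_pM2l// lef_pV2 ?posrE.
    rewrite ler_pdivrMr//.
    have := eh; rewrite -(ler_pM2r w0); lra.
  rewrite exprS -mulrA -/w -natr1; lra.
have -> : expR t = expR h ^+ M by rewrite -expRM_natr hM.
apply: le_trans (H M) _; rewrite !mulrDr mulrC hM -addrA lerD2l.
have c1 : M%:R * (2 * h ^+ 2) <= kappa / 2.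
  have : M%:R * (2 * h ^+ 2) = 2 * t * h by rewrite -hM; ring.
  move=> ->; rewrite /h mulrA ler_pdivrMr//.
  have : 4 * t ^+ 2 / kappa <= M%:R by lra.
  rewrite ler_pdivrMr//; lra.
have c2 : M%:R * (14 / v) <= kappa / 2 by rewrite mulrA ler_pdivrMr//; lra.
lra.
Qed.

(** * The Turan-Kubilius inequality and Daboussi's theorem *)

Lemma big_nat_dvdn (R : nmodType) (F : nat -> R) (q N : nat) : (0 < q)%N ->
  \sum_(1 <= n < N.+1 | (q %| n)%N) F n = \sum_(1 <= m < (N %/ q).+1) F (q * m)%N.
Proof.
move=> q0; elim: N => [|N IH]; first by rewrite div0n !big_geq.
rewrite big_mkcond big_nat_recr//= -big_mkcond /= IH divnS//.
case: ifP => dq; last by rewrite addr0.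
have e : (N %/ q).+1 = (N.+1 %/ q)%N by rewrite divnS// dq.
by rewrite add1n [in RHS]big_nat_recr//= e mulnC divnK.
Qed.

Lemma sum_nat_bool_leq (R : pzSemiRingType) (N K : nat) : (K <= N)%N ->
  \sum_(1 <= m < N.+1) (m <= K)%N%:R = K%:R :> R.
Proof.
move=> KN; rewrite (@big_cat_nat _ _ _ K.+1)//=.
rewrite [X in _ + X]big_nat_cond [X in _ + X]big1 ?addr0; last first.
  by move=> m /andP[/andP[km _] _]; rewrite leqNgt km.
rewrite big_nat_cond (eq_bigr (fun=> 1)); last first.
  by move=> m /andP[/andP[_ km] _]; rewrite -ltnS km.
by rewrite -big_nat_cond big_const_nat subSS subn0 iter_addr addr0.
Qed.

Lemma sum_dvdn (R : pzSemiRingType) (q N : nat) : (0 < q)%N ->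
  \sum_(1 <= n < N.+1) (q %| n)%N%:R = (N %/ q)%:R :> R.
Proof.
move=> q0; rewrite -(sum_nat_bool_leq R (leqnn (N %/ q))).
under eq_bigr do rewrite mulrb.
rewrite -big_mkcond big_nat_dvdn//; apply: eq_big_nat => m /andP[_ km].
by rewrite -ltnS km.
Qed.

Definition recip_sum (R : realType) (P : pred nat) (y : nat) : R :=
  \sum_(0 <= q < y.+1 | P q) q%:R^-1.

Definition omega_in (R : realType) (P : pred nat) (y n : nat) : R :=
  \sum_(0 <= q < y.+1 | P q) (q %| n)%N%:R.

Lemma natr_div_le (R : realType) (N q : nat) :
    (0 < q)%N -> (N %/ q)%:R <= N%:R / q%:R :> R.
Proof. by move=> q0; rewrite ler_pdivlMr ?ltr0n// -natrM ler_nat leq_divM. Qed.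

Lemma sum_omega_sqr (R : realType) (P : pred nat) (y N : nat) :
  (forall q, P q -> prime q) ->
  \sum_(1 <= n < N.+1) omega_in R P y n ^+ 2 <=
    N%:R * (recip_sum R P y ^+ 2 + recip_sum R P y).
Proof.
move=> P_prime; rewrite /omega_in /recip_sum;
    under eq_bigr do rewrite expr2 big_distrlr /=.
rewrite exchange_big /=; under eq_bigr do rewrite exchange_big /=.
rewrite expr2 [in X in _ <= X]big_distrlr /= -big_split /= mulr_sumr.
apply: ler_sum => q /P_prime pq; have q0 := prime_gt0 pq.
have off (r : nat) : P r -> \sum_(1 <= n < N.+1) (q %| n)%N%:R * (r %| n)%N%:R
    <= N%:R * (q%:R^-1 * r%:R^-1 + (r == q)%:R * q%:R^-1) :> R.
  move=> /P_prime pr; have r0 := prime_gt0 pr.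
  have [->|nrq] := eqVneq r q.
    under eq_bigr do rewrite -natrM mulnb andbb.
    rewrite sum_dvdn// mul1r; apply: le_trans (natr_div_le R _ q0) _.
    by rewrite ler_wpM2l// lerDr mulr_ge0.
  rewrite mul0r addr0 -invfM -natrM.
  have cop : coprime q r by rewrite prime_coprime// dvdn_prime2// eq_sym.
  under eq_bigr do rewrite -natrM mulnb -Gauss_dvd//.
  by rewrite sum_dvdn ?muln_gt0 ?q0// natr_div_le// muln_gt0 q0.
apply: le_trans (ler_sum _ (fun r Pr => off r Pr)) _.
rewrite -mulr_sumr big_split /= ler_wpM2l// lerD2l.
rewrite -mulr_suml ler_piMl ?invr_ge0//.
apply: (@le_trans _ _ (\sum_(0 <= r < y.+1 | r == q) 1)).
  rewrite [X in _ <= X]big_mkcond [X in X <= _]big_mkcond; apply: ler_sum => r _.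
  by case: (P r) => //; case: (r == q).
by rewrite big_nat1_eq; case: ifP => //; rewrite ler01.
Qed.

Lemma sum_omega_ge (R : realType) (P : pred nat) (y N : nat) :
  (forall q, P q -> prime q) ->
  N%:R * recip_sum R P y - y.+1%:R <= \sum_(1 <= n < N.+1) omega_in R P y n.
Proof.
move=> P_prime; rewrite /omega_in exchange_big /=.
have h : \sum_(0 <= q < y.+1 | P q) 1 <= y.+1%:R :> R.
  rewrite big_mkcond; apply: (@le_trans _ _ (\sum_(0 <= q < y.+1) 1)).
    by apply: ler_sum => q _; case: ifP.
  by rewrite big_const_nat subn0 iter_addr addr0.
apply: le_trans (lerB (lexx _) h) _; rewrite /recip_sum mulr_sumr -sumrB.
apply: ler_sum => q /P_prime /prime_gt0 q0; rewrite sum_dvdn//.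
by rewrite lerBlDr natr1 ler_pdivrMr ?ltr0n// -natrM ler_nat ltnW// -ltn_divLR.
Qed.

(** When the square is expanded the terms in L^2 cancel; the last summand collects the rounding
    errors of [N %/ q]. *)
Lemma turan_kubilius (R : realType) (P : pred nat) (y N : nat) :
  (forall q, P q -> prime q) ->
  \sum_(1 <= n < N.+1) (omega_in R P y n - recip_sum R P y) ^+ 2 <=
    N%:R * recip_sum R P y + 2 * recip_sum R P y * y.+1%:R.
Proof.
move=> P_prime; set L := recip_sum R P y.
have L0 : 0 <= L by apply: sumr_ge0 => q _; rewrite invr_ge0.
have -> : \sum_(1 <= n < N.+1) (omega_in R P y n - L) ^+ 2 =
  \sum_(1 <= n < N.+1) omega_in R P y n ^+ 2 - 2 * L * \sum_(1 <= n < N.+1) omega_in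
      R P y n
   + N%:R * L ^+ 2.
  have -> : N%:R * L ^+ 2 = \sum_(1 <= n < N.+1) L ^+ 2.
    by rewrite big_const_nat subSS subn0 iter_addr addr0 mulr_natl.
  by rewrite mulr_sumr -sumrB -big_split /=; apply: eq_bigr => n _; ring.
have h1 := sum_omega_sqr R y N P_prime; have h2 := sum_omega_ge R y N P_prime.
have h3 := ler_wpM2l (mulr_ge0 (ler0n R 2) L0) h2.
rewrite -/L in h1 h2 h3; lra.
Qed.

Lemma sum_nat_Cauchy_Schwarz (R : realFieldType) (m n : nat) (a b : nat -> R) :
  (\sum_(m <= i < n) a i * b i) ^+ 2 <=
  (\sum_(m <= i < n) a i ^+ 2) * (\sum_(m <= i < n) b i ^+ 2).
Proof.
by rewrite !big_geq_mkord; exact: sum_Cauchy_Schwarz.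
Qed.

(** Multiplication by 2 sin (th / 2) makes the sum telescope. *)
Lemma norm_sum_cos_le (R : realType) (th phi : R) (m n : nat) :
  sin (th / 2) != 0 ->
  `|\sum_(m <= i < n) cos (th * i%:R + phi)| <= `|sin (th / 2)|^-1.
Proof.
move=> s0.
have tel k : (m <= k)%N -> 2 * sin (th / 2) * \sum_(m <= i < k) cos (th * i%:R + phi) =
   sin (th * k%:R + phi - th / 2) - sin (th * m%:R + phi - th / 2).
  move=> mk; rewrite -(subnKC mk); elim: (k - m)%N => [|j IH].
    by rewrite addn0 big_geq// mulr0 subrr.
  rewrite addnS big_nat_recr ?leq_addr//= mulrDr IH.
  set x := th * (m + j)%:R + phi.
  have -> : th * (m + j).+1%:R + phi - th / 2 = x + th / 2 by rewrite -natr1 /x; field.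
  by rewrite (sinD x (th / 2)) (sinB x); ring.
have [nm|mn] := ltnP n m.
  by rewrite big_geq ?(ltnW nm)// normr0 invr_ge0.
have := tel n mn; set S := \sum_(_ <= _ < _) _ => e.
have s1 : `|2 * sin (th / 2) * S| <= 2.
  rewrite e; apply: le_trans (ler_normB _ _) _.
  by have := sin_max (th * n%:R + phi - th / 2);
    have := sin_max (th * m%:R + phi - th / 2); lra.
rewrite -[X in _ <= X]mulr1 ler_pdivlMl ?normr_gt0//.
by move: s1; rewrite !normrM ger0_norm//; lra.
Qed.

(* [(-1) ^+ neg n] is completely multiplicative up to [N]. *)
Definition mult_sign (neg : nat -> bool) (N : nat) :=
  forall m n, (0 < m)%N -> (0 < n)%N -> (m * n <= N)%N ->
    neg (m * n)%N = neg m (+) neg n.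

Lemma norm_sum_cos_mul_le (R : realType) (th phi : R) (a b : nat) (m n : nat) :
  sin (((a + b)%N%:R * th) / 2) != 0 -> sin ((`|a%:Z - b%:Z|%N%:R * th) / 2) != 0 ->
  `|\sum_(m <= i < n) cos (th * (a * i)%N%:R + phi) * cos (th * (b * i)%N%:R + phi)| <=
  `|sin (((a + b)%N%:R * th) / 2)|^-1 + `|sin ((`|a%:Z - b%:Z|%N%:R * th) / 2)|^-1.
Proof.
wlog ba : a b / (b <= a)%N.
  move=> H; case: (leqP b a) => [|/ltnW] ab h1 h2; first exact: H.
  have := H b a ab; rewrite addnC distnC => /(_ h1 h2).
  by under eq_bigr do rewrite mulrC.
rewrite distnEl// => h1 h2.
have -> : \sum_(m <= i < n) cos (th * (a * i)%N%:R + phi) * cos (th * (b * i)%N%:R +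
    phi) =
   (\sum_(m <= i < n) cos ((a + b)%N%:R * th * i%:R + 2 * phi) +
    \sum_(m <= i < n) cos ((a - b)%N%:R * th * i%:R + 0)) / 2.
  rewrite -big_split /= mulr_suml; apply: eq_bigr => i _.
  set x := th * _ + phi; set z := th * _ + phi.
  have -> : (a + b)%N%:R * th * i%:R + 2 * phi = x + z
    by rewrite /x /z natrD !natrM; ring.
  have -> : (a - b)%N%:R * th * i%:R + 0 = x - z by rewrite /x /z natrB// !natrM; ring.
  by rewrite (cosD x z) (cosB x z); field.
have g1 := norm_sum_cos_le (2 * phi) m n h1; have g2 := norm_sum_cos_le 0 m n h2.
rewrite normrM (@ger0_norm _ 2^-1)//;
    apply: le_trans (ler_wpM2r _ (ler_normD _ _)) _ => //.
have i1 : 0 <= `|sin ((a + b)%:R * th / 2)|^-1 by rewrite invr_ge0.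
have i2 : 0 <= `|sin ((a - b)%:R * th / 2)|^-1 by rewrite invr_ge0.
move: g1 g2 i1 i2; move: (_^-1) (_^-1) => u w; lra.
Qed.

Lemma sum_range_natrM (R : comPzRingType) (F : nat -> R) (K N : nat) : (K <= N)%N ->
  \sum_(1 <= m < N.+1) (m <= K)%N%:R * F m = \sum_(1 <= m < K.+1) F m.
Proof.
move=> KN; rewrite (@big_cat_nat _ _ _ K.+1)//=.
rewrite [X in _ + X]big_nat_cond [X in _ + X]big1 ?addr0; last first.
  by move=> m /andP[/andP[km _] _]; rewrite leqNgt km mul0r.
by apply: eq_big_nat => m /andP[_ km]; rewrite -ltnS km mul1r.
Qed.

Section Katai.
Variables (R : realType) (th phi : R) (y N : nat) (neg : nat -> bool).
Hypothesis sin_neq0 : forall j, (0 < j)%N -> sin (j%:R * th / 2) != 0.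
Hypothesis neg_mult : mult_sign neg N.

Let psi (n : nat) : R := cos (th * n%:R + phi).
Let g (n : nat) : R := (-1) ^+ neg n.
(** The weight that m receives when n is written as q m with q a prime up to [y]; the boolean factor
    encodes q m <= N. *)
Let c (m : nat) : R :=
  \sum_(0 <= q < y.+1 | prime q) (m <= N %/ q)%N%:R * (g q * psi (q * m)%N).
(** One constant dominating the bounds for every frequency q + r and |q - r| with q, r <= y; it
    involves neither [N] nor [neg]. *)
Let D : R := \sum_(1 <= j < y.*2.+1) `|sin (j%:R * th / 2)|^-1.
Let L : R := recip_sum R prime y.

(** Complete multiplicativity takes g m out of the inner sum, also when q divides m. Cauchy-Schwarz
    can then discard the unknown signs g m. *)
Lemma katai_rearrange :
  \sum_(1 <= n < N.+1) g n * psi n * omega_in R prime y n =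
  \sum_(1 <= m < N.+1) g m * c m.
Proof.
under eq_bigr do rewrite /omega_in mulr_sumr.
under [RHS]eq_bigr do rewrite /c mulr_sumr.
rewrite exchange_big [RHS]exchange_big /=; apply: eq_bigr => q /prime_gt0 q0.
under eq_bigr do rewrite mulr_natr mulrb.
rewrite -big_mkcond big_nat_dvdn//.
under [RHS]eq_bigr do rewrite mulrCA.
rewrite sum_range_natrM ?leq_div//; apply: eq_big_nat => m /andP[m0 mN].
rewrite mulrA; congr (_ * _); rewrite /g neg_mult//; last first.
  by rewrite mulnC -leq_divRL.
by rewrite signr_addb mulrC.
Qed.

(** For q different from r the signs enter only through the constant factor g q g r, so the bound is
    uniform in [neg]; what remains is a product of two cosines of distinct frequencies. *)
Lemma katai_offdiag (q r : nat) : prime q -> prime r -> (q <= y)%N -> (r <= y)%N ->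
  \sum_(1 <= m < N.+1) ((m <= N %/ q)%N%:R * (g q * psi (q * m)%N)) *
     ((m <= N %/ r)%N%:R * (g r * psi (r * m)%N)) <=
  (r == q)%:R * (N%:R * q%:R^-1) + 2 * D.
Proof.
move=> pq pr qy ry; have q0 := prime_gt0 pq; have r0 := prime_gt0 pr.
have D0 : 0 <= D by apply: sumr_ge0 => j _; rewrite invr_ge0.
have psi1 n : psi n ^+ 2 <= 1.
  by rewrite -[X in _ <= X](expr1n _ 2) -real_normK ?num_real// lerXn2r ?nnegrE//
      cos_max.
have g2 n : g n ^+ 2 = 1 by rewrite /g sqrr_sign.
have gn n : `|g n| = 1 by rewrite /g normr_sign.
have [->|nrq] := eqVneq r q.
  rewrite mul1r; apply: (@le_trans _ _ (N%:R * q%:R^-1));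
      last by rewrite lerDl mulr_ge0.
  apply: le_trans (natr_div_le R N q0).
  rewrite -(sum_nat_bool_leq R (leq_div N q)); apply: ler_sum => m _.
  case: (m <= _)%N; last by rewrite !mul0r.
  by rewrite !mul1r mulrACA -!expr2 g2 mul1r.
rewrite mul0r add0r.
have Db j : (0 < j)%N -> (j <= y.*2)%N -> `|sin (j%:R * th / 2)|^-1 <= D.
  move=> j0 jy; rewrite /D (@big_cat_nat _ _ _ j)//=; last by rewrite (leq_trans jy).
  rewrite [X in _ <= _ + X]big_ltn ?ltnS// addrCA lerDl addr_ge0// sumr_ge0// => i _;
      by rewrite invr_ge0.
pose K := minn (N %/ q) (N %/ r).
have -> : \sum_(1 <= m < N.+1) ((m <= N %/ q)%N%:R * (g q * psi (q * m)%N)) *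
     ((m <= N %/ r)%N%:R * (g r * psi (r * m)%N)) =
   g q * g r * \sum_(1 <= m < K.+1) psi (q * m)%N * psi (r * m)%N.
  rewrite -(@sum_range_natrM _ _ K N) ?geq_min ?leq_div// mulr_sumr.
  by apply: eq_bigr => m _; rewrite leq_min -mulnb natrM; ring.
apply: le_trans (ler_norm _) _; rewrite !normrM !gn !mul1r.
have d1 : (0 < q + r)%N by rewrite addn_gt0 q0.
have d2 : (0 < `|q%:Z - r%:Z|)%N by move: nrq; lia.
apply: le_trans (norm_sum_cos_mul_le _ _ _ (sin_neq0 d1) (sin_neq0 d2)) _.
have := Db _ d1 _; have := Db _ d2 _.
have e1 : (q + r <= y.*2)%N by lia.
have e2 : (`|q%:Z - r%:Z| <= y.*2)%N by lia.
by move=> /(_ e2) b2 /(_ e1) b1; rewrite [2 * D]mulr_natl mulr2n; exact: lerD.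
Qed.

Lemma katai_second_moment :
  \sum_(1 <= m < N.+1) c m ^+ 2 <= N%:R * L + 2 * D * y.+1%:R ^+ 2.
Proof.
have D0 : 0 <= D by apply: sumr_ge0 => j _; rewrite invr_ge0.
under eq_bigr do rewrite expr2 /c big_distrlr /=.
rewrite exchange_big /=; under eq_bigr do rewrite exchange_big /=.
have card1 (F : R) : 0 <= F -> \sum_(0 <= q < y.+1 | prime q) F <= y.+1%:R * F.
  move=> F0; rewrite big_mkcond; apply: (@le_trans _ _ (\sum_(0 <= q < y.+1) F)).
    by apply: ler_sum => q _; case: ifP.
  by rewrite big_const_nat subn0 iter_addr addr0 mulr_natl.
apply: (@le_trans _ _ (\sum_(0 <= q < y.+1 | prime q) (N%:R * q%:R^-1 + y.+1%:R * (2
    * D)))).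
  rewrite big_nat_cond [X in _ <= X]big_nat_cond.
  apply: ler_sum => q /andP[/andP[_ qy] pq].
  apply: le_trans (_ : \sum_(0 <= r < y.+1 | prime r) ((r == q)%:R * (N%:R * q%:R^-1)
      + 2 * D) <= _).
    rewrite big_nat_cond [X in _ <= X]big_nat_cond.
    by apply: ler_sum => r /andP[/andP[_ ry] pr]; apply: katai_offdiag.
  rewrite big_split /=; apply: lerD; last by rewrite card1// mulr_ge0.
  rewrite -mulr_suml ler_piMl// ?mulr_ge0 ?invr_ge0//.
  apply: (@le_trans _ _ (\sum_(0 <= r < y.+1 | r == q) 1)).
    rewrite [X in _ <= X]big_mkcond [X in X <= _]big_mkcond; apply: ler_sum => r _.
    by case: (prime r) => //; case: (r == q).
  by rewrite big_nat1_eq; case: ifP => //; rewrite ler01.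
rewrite big_split /= -mulr_sumr lerD2l; apply: le_trans (card1 _ _) _.
  by rewrite !mulr_ge0.
by rewrite le_eqVlt; apply/orP; left; apply/eqP; ring.
Qed.

(** Replacing L by omega turns L S into U, up to the fluctuation V. The second moment of [c]
    controls U, the Turan-Kubilius inequality controls V, and (U - V)^2 <= 2 U^2 + 2 V^2. *)
Lemma katai_bound :
  (L * \sum_(1 <= n < N.+1) g n * psi n) ^+ 2 <=
  2 * N%:R * (N%:R * L + 2 * D * y.+1%:R ^+ 2) + 2 * N%:R * (N%:R * L + 2 * L *
      y.+1%:R).
Proof.
set S := \sum_(1 <= n < N.+1) g n * psi n.
pose U := \sum_(1 <= m < N.+1) g m * c m.
pose V := \sum_(1 <= n < N.+1) g n * psi n * (omega_in R prime y n - L).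
have e : L * S = U - V.
  rewrite /U -katai_rearrange /V -sumrB mulr_sumr; apply: eq_bigr => n _; ring.
have gsum (a : nat -> R) : (forall n,
    `|a n| <= 1) -> \sum_(1 <= n < N.+1) a n ^+ 2 <= N%:R.
  move=> a1; apply: (@le_trans _ _ (\sum_(1 <= n < N.+1) 1)).
    apply: ler_sum => n _; rewrite -[X in _ <= X](expr1n _ 2) -real_normK ?num_real//.
    by rewrite lerXn2r ?nnegrE.
  by rewrite big_const_nat subSS subn0 iter_addr addr0.
have sq0 (a : nat -> R) : 0 <= \sum_(1 <= n < N.+1) a n ^+ 2.
  by apply: sumr_ge0 => n _; exact: sqr_ge0.
have hU : U ^+ 2 <= N%:R * (N%:R * L + 2 * D * y.+1%:R ^+ 2).
  apply: le_trans (sum_nat_Cauchy_Schwarz _ _ _ _) _.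
  apply: ler_pM => //; last exact: katai_second_moment.
  by apply: gsum => n; rewrite /g normr_sign.
have hV : V ^+ 2 <= N%:R * (N%:R * L + 2 * L * y.+1%:R).
  apply: le_trans (sum_nat_Cauchy_Schwarz _ _ _ _) _.
  apply: ler_pM => //; last exact: turan_kubilius.
  by apply: gsum => n; rewrite /g normrM normr_sign mul1r cos_max.
rewrite e; have := sqr_ge0 (U + V); lra.
Qed.
End Katai.

(** First [y] is fixed by L >= 8 / eps^2; then N is taken so large that Q <= N L, which gives L S^2
    <= 8 N^2. The threshold is chosen before [neg] and [phi], which is the uniformity in p needed
    later. *)
Lemma daboussi_cos (R : realType) (th eps : R) :
  (forall j, (0 < j)%N -> sin (j%:R * th / 2) != 0) -> 0 < eps ->
  exists N0 : nat, forall N, (N0 <= N)%N -> forall neg, mult_sign neg N ->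
  forall phi, `|\sum_(1 <= n < N.+1) (-1) ^+ neg n * cos (th * n%:R + phi)| <= eps *
      N%:R.
Proof.
move=> sin0 eps0.
have [y Ly] := @prime_recip_unbounded R (8 / eps ^+ 2).
pose L := recip_sum R prime y; have {}Ly : 8 / eps ^+ 2 <= L := Ly.
pose D : R := \sum_(1 <= j < y.*2.+1) `|sin (j%:R * th / 2)|^-1.
pose Q := 2 * D * y.+1%:R ^+ 2 + 2 * L * y.+1%:R.
have e2 : 0 < eps ^+ 2 by rewrite exprn_gt0.
have L0 : 0 < L by apply: lt_le_trans Ly; rewrite divr_gt0.
have LE : 8 <= L * eps ^+ 2 by rewrite -ler_pdivrMr.
exists (Num.truncn (Q / L)).+1 => N NQ neg negm phi.
have N0 : 0 <= N%:R :> R by [].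
have NL : Q <= N%:R * L.
  rewrite -ler_pdivrMr//; apply: ltW; apply: lt_le_trans (truncnS_gt _) _.
  by rewrite ler_nat.
have := @katai_bound R th phi y N neg sin0 negm; rewrite -/L -/D.
set S := \sum_(_ <= _ < _) _ => h.
rewrite -(ler_pXn2r (n := 2)) ?nnegrE ?mulr_ge0 ?(ltW eps0)// real_normK ?num_real//.
have NNL : N%:R * Q <= N%:R * (N%:R * L) by rewrite ler_wpM2l.
have LN : 0 <= L * N%:R ^+ 2 by rewrite mulr_ge0 ?sqr_ge0 ?ltW.
have h2 : L * (L * S ^+ 2) <= L * (8 * N%:R ^+ 2) by rewrite /Q in NNL; lra.
rewrite ler_pM2l// in h2.
have h3 : 8 * S ^+ 2 <= L * eps ^+ 2 * S ^+ 2 by rewrite ler_wpM2r ?sqr_ge0.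
have h4 : eps ^+ 2 * (L * S ^+ 2) <= eps ^+ 2 * (8 * N%:R ^+ 2) by rewrite ler_pM2l.
lra.
Qed.

(** * Density of quadratic residues and nonresidues *)

Definition sign_count (neg : nat -> bool) (s : bool) (y : nat) : nat :=
  \sum_(1 <= n < y.+1) (neg n == s).

Lemma sign_countC neg s y : (sign_count neg s y + sign_count neg (~~ s) y = y)%N.
Proof.
rewrite /sign_count -big_split /= (eq_bigr (fun=> 1%N)); last first.
  by move=> n _; case: (neg n); case: s.
by rewrite sum_nat_const_nat subn1 muln1.
Qed.

Definition neg_prime (neg : nat -> bool) : pred nat := [pred q | prime q && neg q].

Lemma neg_primeP neg q : neg_prime neg q -> prime q.
Proof. by case/andP. Qed.

Lemma sum_sign_omega (R : realType) (neg : nat -> bool) (s : bool) (N y : nat) :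
  mult_sign neg N ->
  \sum_(1 <= n < N.+1) (neg n == s)%:R * omega_in R (neg_prime neg) y n =
  \sum_(0 <= q < y.+1 | neg_prime neg q) (sign_count neg (~~ s) (N %/ q))%:R.
Proof.
move=> negm; under eq_bigr do rewrite /omega_in mulr_sumr.
rewrite exchange_big /=; apply: eq_bigr => q /andP[/prime_gt0 q0 negq].
under eq_bigr do rewrite mulr_natr mulrb.
rewrite -big_mkcond big_nat_dvdn// /sign_count natr_sum.
apply: eq_big_nat => m /andP[m0 mN]; rewrite negm//; last by rewrite mulnC -leq_divRL.
by rewrite negq; case: (neg m); case: s.
Qed.

(* If the sign [s] is rare at all scales, the products [q m] with [q] a prime of
   sign [-1] and [m] of sign [- s], counted with the second moment of omega,
   show that such primes are rare. *)
Lemma neg_primes_rare (R : realType) (eta : R) (neg : nat -> bool) (s : bool) (N0 N :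
    nat) :
  0 < eta -> eta <= 1 / 32 -> (0 < N0)%N -> mult_sign neg N ->
  (forall y, (N0 <= y <= N)%N -> (sign_count neg s y)%:R <= eta * y%:R) ->
  recip_sum R (neg_prime neg) (N %/ N0) <= 32 * eta.
Proof.
move=> eta0 eta1 N00 negm rare; set y := (N %/ N0)%N; set S := recip_sum _ _ _.
have S0 : 0 <= S by apply: sumr_ge0 => q _; rewrite invr_ge0.
have [NN0|N0N] := ltnP N N0.
  rewrite /S /recip_sum /y divn_small// big_nat_cond big1 ?mulr_ge0 ?ltW//.
  move=> q /andP[/andP[_ q1] /andP[/prime_gt0 q0 _]].
  by move: q1; rewrite ltnS leqNgt q0.
have Npos : 0 < N%:R :> R by rewrite ltr0n (leq_trans N00).
pose X := \sum_(1 <= n < N.+1) (neg n == s)%:R * omega_in R (neg_prime neg) y n.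
(* For q <= N / N0 the scale M = N %/ q is at least N0, so the opposite sign occupies at least
   (31/32) M >= (M + 1) / 4 integers. *)
have Xlow : N%:R * S / 4 <= X.
  rewrite /X sum_sign_omega// /S /recip_sum mulr_sumr mulr_suml.
  rewrite big_nat_cond [X in _ <= X]big_nat_cond.
  apply: ler_sum => q /andP[/andP[_ qy] /andP[/prime_gt0 q0 _]].
  have qN : (N0 <= N %/ q)%N by rewrite leq_divRL// mulnC -leq_divRL.
  have := rare (N %/ q)%N; rewrite qN leq_div => /(_ isT) hr.
  have hC : (sign_count neg s (N %/ q))%:R + (sign_count neg (~~ s) (N %/ q))%:R = (N
      %/ q)%:R :> R.
    by rewrite -natrD sign_countC.
  have M1 : 1 <= (N %/ q)%:R :> R by rewrite ler1n (leq_trans N00).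
  have hM : N%:R / q%:R <= (N %/ q)%:R + 1 :> R.
    by rewrite natr1 ler_pdivrMr ?ltr0n// -natrM ler_nat ltnW// -ltn_divLR.
  have hs : eta * (N %/ q)%:R <= 1 / 32 * (N %/ q)%:R by rewrite ler_wpM2r.
  lra.
have Xup : X ^+ 2 <= eta * N%:R * (N%:R * (S ^+ 2 + S)).
  apply: le_trans (sum_nat_Cauchy_Schwarz _ _ _ _) _; apply: ler_pM.
  - by apply: sumr_ge0 => n _; exact: sqr_ge0.
  - by apply: sumr_ge0 => n _; exact: sqr_ge0.
  - apply: le_trans (rare N _); last by rewrite N0N leqnn.
    rewrite /sign_count natr_sum; apply: ler_sum => n _.
    by case: (_ == _); rewrite ?expr1n ?expr0n.
  - by apply: sum_omega_sqr => q; exact: neg_primeP.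
have X4 : (N%:R * S / 4) ^+ 2 <= eta * N%:R * (N%:R * (S ^+ 2 + S)).
  apply: le_trans Xup; rewrite lerXn2r ?nnegrE//; first by rewrite divr_ge0 ?mulr_ge0.
  by apply: le_trans Xlow; rewrite divr_ge0 ?mulr_ge0.
have N2 : 0 < N%:R ^+ 2 :> R by rewrite exprn_gt0.
(* After division by N^2 this reads S^2 <= 16 eta (S^2 + S); as 16 eta <= 1/2, it yields S <= 32
   eta. *)
have h : N%:R ^+ 2 * S ^+ 2 <= N%:R ^+ 2 * (16 * eta * (S ^+ 2 + S)) by lra.
rewrite ler_pM2l// in h.
have [->|Sn0] := eqVneq S 0; first by rewrite mulr_ge0 ?ltW.
have Sp : 0 < S by rewrite lt_def Sn0.
have h' : S * S <= S * (16 * eta * (S + 1)) by lra.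
rewrite ler_pM2l// in h'.
have : 16 * eta * S <= 1 / 2 * S by rewrite ler_pM2r//; lra.
lra.
Qed.

Lemma neg_has_neg_prime (neg : nat -> bool) (x n : nat) : mult_sign neg x ->
  (0 < n)%N -> (n <= x)%N -> neg n -> exists2 q, neg_prime neg q & (q %| n)%N.
Proof.
move=> negm; elim/ltn_ind: n => n IH n0 nx negn.
have neg1 : neg 1%N = false.
  by have := negm 1%N 1%N isT isT; rewrite muln1 => /(_ (leq_trans n0 nx)) ->;
      rewrite addbb.
have n1 : (1 < n)%N by case: n n0 negn {IH nx} => [|[|]]//; rewrite neg1.
have pq := pdiv_prime n1; have dq := pdiv_dvd n.
have m0 : (0 < n %/ pdiv n)%N by rewrite divn_gt0 ?prime_gt0// dvdn_leq.
have e : (pdiv n * (n %/ pdiv n) = n)%N by rewrite mulnC divnK.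
have := negm (pdiv n) (n %/ pdiv n)%N (prime_gt0 pq) m0; rewrite e negn => /(_ nx).
have [negq _|_ /= negm'] := boolP (neg (pdiv n)).
  by exists (pdiv n) => //; rewrite /neg_prime /= pq.
have [|||q Pq dqm] := IH (n %/ pdiv n)%N _ m0 => //.
- by rewrite ltn_Pdiv ?prime_gt1.
- by rewrite (leq_trans (leq_div _ _)).
by exists q => //; rewrite -e dvdn_mull.
Qed.

Lemma sign_count_le_recip (R : realType) (neg : nat -> bool) (x : nat) :
    mult_sign neg x ->
  (sign_count neg true x)%:R <= x%:R * recip_sum R (neg_prime neg) x.
Proof.
move=> negm; apply: (@le_trans _ _ (\sum_(1 <= n < x.+1) omega_in R (neg_prime neg) x
    n)).
  rewrite /sign_count natr_sum big_nat_cond [X in _ <= X]big_nat_cond.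
  apply: ler_sum => n /andP[/andP[n0 nx] _].
  have om0 : 0 <= omega_in R (neg_prime neg) x n by apply: sumr_ge0.
  case: eqP => [negn|//]; have [q Pq dq] := neg_has_neg_prime negm n0 nx negn.
  have qx : (q <= x)%N by rewrite (leq_trans (dvdn_leq _ dq)).
  rewrite /omega_in (@big_cat_nat _ _ _ q)//=; last by rewrite ltnW.
  rewrite [X in _ <= _ + X]big_ltn_cond ?ltnS// Pq dq addrCA lerDl.
  by rewrite addr_ge0// sumr_ge0.
rewrite exchange_big /= /recip_sum mulr_sumr;
    apply: ler_sum => q /neg_primeP /prime_gt0 q0.
by rewrite sum_dvdn// natr_div_le.
Qed.

(** If the sign +1 were rare at every scale, the primes of sign -1 up to N0 would have reciprocal
    sum at most 32 eta <= 1/2. Both signs together would then fail to fill [1, N0]. *)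
Lemma sign_count_false_dense (R : realType) (eta : R) (neg : nat -> bool) (N0 : nat) :
  0 < eta -> eta <= 1 / 64 -> (0 < N0)%N -> mult_sign neg (N0 * N0) ->
  exists2 y, (N0 <= y <= N0 * N0)%N & eta * y%:R <= (sign_count neg false y)%:R.
Proof.
move=> eta0 eta1 N00 negm; apply: contrapT => none.
have rare y : (N0 <= y <= N0 * N0)%N -> (sign_count neg false y)%:R <= eta * y%:R.
  by move=> yN; rewrite leNgt; apply/negP => /ltW h; apply: none; exists y.
have e2 : eta <= 1 / 32 by lra.
have := neg_primes_rare eta0 e2 N00 negm rare; rewrite mulnK// => S.
have negN0 : mult_sign neg N0.
  by move=> m n m0 n0 mn; apply: negm => //; rewrite (leq_trans mn)// leq_pmulr.
have h1 := @sign_count_le_recip R neg N0 negN0.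
have NR : 0 < N0%:R :> R by rewrite ltr0n.
have h2 : N0%:R * recip_sum R (neg_prime neg) N0 <= N0%:R * (32 * eta)
  by rewrite ler_pM2l.
have h3 : (sign_count neg false N0)%:R <= eta * N0%:R
  by apply: rare; rewrite leqnn leq_pmulr.
have h4 : (sign_count neg false N0)%:R + (sign_count neg true N0)%:R = N0%:R :> R.
  by rewrite -natrD (sign_countC neg false).
have h5 : eta * N0%:R <= 1 / 64 * N0%:R by rewrite ler_pM2r.
lra.
Qed.

(* Euler's criterion; only meaningful for [p] odd and [0 < n < p]. *)
Definition nonres (p n : nat) : bool := (n%:R : 'F_p) ^+ p./2 == -1.

Lemma Fp_natr_neq0 (p n : nat) : prime p -> (0 < n)%N -> (n < p)%N -> n%:R != 0 :> 'F_p.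
Proof. by move=> pp n0 np; rewrite -(dvdn_pcharf (pchar_Fp pp)) gtnNdvd. Qed.

Lemma nonres_mult (p N : nat) : prime p -> odd p -> (N < p)%N -> mult_sign (nonres p) N.
Proof.
move=> pp oddp Np m n m0 n0 mnN; rewrite /nonres natrM exprMn.
have mp : (m < p)%N by rewrite (leq_ltn_trans _ Np)// (leq_trans _ mnN)// leq_pmulr.
have np : (n < p)%N by rewrite (leq_ltn_trans _ Np)// (leq_trans _ mnN)// leq_pmull.
have n1 := Fp_opp1_neq1 pp oddp.
have n1' : (1 == -1 :> 'F_p) = false by rewrite eq_sym (negPf n1).
by case: (Fp_exp_half pp oddp (Fp_natr_neq0 pp m0 mp)) (Fp_exp_half pp oddp
    (Fp_natr_neq0 pp n0 np))
  => -> [] ->; rewrite ?mul1r ?mulr1 ?mulrNN ?mulr1 ?n1' ?eqxx.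
Qed.

Lemma qchar_nonres (R : pzRingType) (p n : nat) : prime p -> odd p ->
  (0 < n)%N -> (n < p)%N -> qchar R (n%:R : 'F_p) = (-1) ^+ nonres p n.
Proof.
move=> pp oddp n0 np; have nz := Fp_natr_neq0 pp n0 np.
rewrite /qchar /nonres (negPf nz).
have n1 := Fp_opp1_neq1 pp oddp.
by case: (Fp_exp_half pp oddp nz) => ->; rewrite ?eqxx ?(negPf n1)// eq_sym (negPf n1).
Qed.

Lemma sum_qchar_sign_count (R : realType) (p x : nat) : prime p -> odd p -> (x < p)%N ->
  \sum_(n < x) qchar R (n.+1%:R : 'F_p) = x%:R - 2 * (sign_count (nonres p) true x)%:R.
Proof.
move=> pp oddp xp; rewrite -(big_mkord xpredT (fun n => qchar R (n.+1%:R : 'F_p))).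
rewrite /sign_count natr_sum [in RHS]big_add1 /= mulr_sumr.
have -> : x%:R = \sum_(0 <= n < x) 1 :> R
  by rewrite big_const_nat subn0 iter_addr addr0.
rewrite -sumrB; apply: eq_big_nat => n /andP[_ nx].
rewrite qchar_nonres//; last exact: leq_ltn_trans xp.
by case: (nonres p n.+1) => /=; rewrite ?expr1 ?expr0 ?mulr1 ?mulr0 ?subr0//; lra.
Qed.

Lemma prime_recip_le (R : realType) (m n : nat) : (m <= n)%N ->
  prime_recip R m <= prime_recip R n.
Proof.
move=> mn; rewrite -subr_ge0 prime_recipB//.
by apply: sumr_ge0 => q _; rewrite invr_ge0.
Qed.

Lemma recip_sum_split (R : realType) (P : pred nat) (m n : nat) : (m <= n)%N ->
  (forall q, P q -> prime q) ->
  recip_sum R P n <= recip_sum R P m + (prime_recip R n - prime_recip R m).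
Proof.
move=> mn Pp; rewrite prime_recipB// /recip_sum (@big_cat_nat _ _ _ m.+1)//= lerD2l.
rewrite big_mkcond [X in _ <= X]big_mkcond; apply: ler_sum => q _.
case: ifP => [/Pp ->//|_]; case: ifP => // _; by rewrite invr_ge0.
Qed.

(** [eta] is chosen before [N0] because the scale supplied by [sign_bohr_hit] will depend on
    [eta]. *)
Lemma sign_count_dense (R : realType) (eps : R) : 0 < eps ->
  exists2 eta : R, 0 < eta & forall N0 : nat, (0 < N0)%N ->
  exists p0 : nat, forall p, prime p -> (p0 <= p)%N -> forall s : bool,
  exists y : nat, [/\ (N0 <= y)%N, (y < p)%N,
    y%:R <= expR ((1 / (4 * expR (1 / 2)) + eps) * ln p%:R) &
    eta * y%:R <= (sign_count (nonres p) s y)%:R].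
Proof.
move=> eps0.
wlog eps1 : eps eps0 / eps <= 1 / 8.
  move=> H; pose e1 := Num.min eps (1 / 8).
  have e10 : 0 < e1 by rewrite lt_min eps0; lra.
  have e1l : e1 <= eps by rewrite ge_min lexx.
  have [eta eta0 He] := H e1 e10 ltac:(by rewrite ge_min lexx orbT).
  exists eta => // N0 N00; have [p0 Hp] := He N0 N00; exists p0 => p pp p0p s.
  have [y [y1 y2 y3 y4]] := Hp p pp p0p s; exists y; split=> //.
  apply: le_trans y3 _; rewrite ler_expR ler_wpM2r ?lerD2l//.
  by rewrite ln_ge0// ler1n prime_gt0.
pose E : R := expR (1 / 2).
have E1 : 1 <= E by rewrite -(expR0 R) ler_expR; lra.
have E0 : 0 < E by lra.
have E2 : E <= 2.
  have h1 : E * expR (- (1 / 2)) = 1 by rewrite -expRD subrr expR0.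
  have h2 := expR_ge1Dx (- (1 / 2) : R).
  have h3 : E * (1 / 2) <= E * expR (- (1 / 2)) by rewrite ler_pM2l//; lra.
  lra.
pose a0 := 1 / (4 * E).
have a0E : a0 * E = 1 / 4 by rewrite /a0; field; rewrite gt_eqF.
have a00 : 0 < a0 by rewrite divr_gt0 ?mulr_gt0.
have a01 : a0 <= 1 / 4.
  have : a0 * 1 <= a0 * E by rewrite ler_pM2l.
  lra.
(* With this [c], E (a0 + eps / 2) = 1/4 + c/4. The margin c/4 over Burgess' exponent pays for
   [delta] and for the factor expR (- (2 kappa)) lost in expR t. *)
pose c := 2 * eps * E.
have c0 : 0 < c by rewrite mulr_gt0 ?mulr_gt0.
have c1 : c <= 1.
  have : eps * E <= 1 / 8 * 2 by apply: ler_pM => //; exact: ltW.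
  rewrite /c; lra.
pose kappa := c / 16.
pose delta := c / 8.
pose t : R := 1 / 2 - 2 * kappa.
pose eta := kappa / 128.
have k0 : 0 < kappa by rewrite divr_gt0.
have d0 : 0 < delta by rewrite divr_gt0.
have t0 : 0 < t by rewrite /t /kappa; lra.
have key : 1 / 4 + delta <= expR t * (a0 + eps / 2).
  have h1 : expR t = E * expR (- (2 * kappa)) by rewrite -expRD.
  have h2 : 1 + - (2 * kappa) <= expR (- (2 * kappa)) := expR_ge1Dx _.
  have h3 : E * (a0 + eps / 2) * (1 + - (2 * kappa)) <= E * (a0 + eps / 2) * expR (-
      (2 * kappa)).
    by rewrite ler_wpM2l// mulr_ge0 ?(ltW E0)//; lra.
  have h4 : E * (a0 + eps / 2) = 1 / 4 + c / 4 by rewrite mulrDr mulrC a0E /c; field.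
  have h5 : 0 <= c * (1 - c) by rewrite mulr_ge0; lra.
  rewrite h1; rewrite h4 in h3; rewrite mulrAC h4 /delta; rewrite /kappa in h3 *; lra.
have [V V0 HV] := prime_recip_exp_ratio t0 k0.
have [pb Hb] := @burgess_asymptotic R delta (kappa / 3) d0 ltac:(rewrite /delta;
    lra) ltac:(lra) ltac:(rewrite /kappa; lra).
exists eta => [|N0 N00]; first by rewrite divr_gt0.
have [p1 P1] := @expR_ln_nat_large R (N0%:R) (eps / 2) ltac:(lra).
have [p2 P2] := @expR_ln_nat_large R ((N0 * N0)%:R) eps eps0.
have [p3 P3] := @expR_ln_nat_large R (expR (V / (a0 + eps / 2))) 1 ltac:(lra).
exists (maxn 3 (maxn pb (maxn p1 (maxn p2 p3)))) => p pp.
rewrite !geq_max => /and5P[p_3 pbp /P1{P1} F1 /P2{P2} F2 /P3{P3} F3] s.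
have p0R : 0 < p%:R :> R by rewrite ltr0n prime_gt0.
have oddp : odd p by case: (even_prime pp) p_3 => [->|].
set L := ln p%:R in F1 F2 F3.
have L0 : 0 < L by rewrite ln_gt0// ltr1n prime_gt1.
have e1 : expR (1 * L) = p%:R by rewrite mul1r lnK.
have ltp (n : nat) (a : R) : a < 1 -> n%:R <= expR (a * L) -> (n < p)%N.
  by move=> a1 h; rewrite -(ltr_nat R) -e1; apply: le_lt_trans h _;
      rewrite ltr_expR ltr_pM2r.
rewrite -/E -/a0 -/L.
have a1 : a0 + eps < 1 by lra.
case: s; last first.
  have N0N0 : (N0 * N0)%:R <= expR ((a0 + eps) * L).
    by apply: le_trans F2 _; rewrite ler_expR ler_pM2r//; lra.
  have [y /andP[y1 y2] y3] := @sign_count_false_dense R eta (nonres p) N0 ltac:(by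
      rewrite divr_gt0)
     ltac:(rewrite /eta /kappa; lra) N00 (nonres_mult pp oddp (ltp _ _ a1 N0N0)).
  have yN : y%:R <= (N0 * N0)%:R :> R by rewrite ler_nat.
  have yle := le_trans yN N0N0.
  by exists y; split=> //; exact: ltp yle.
pose N := Num.truncn (expR ((a0 + eps) * L)).
have Nle : N%:R <= expR ((a0 + eps) * L) by rewrite truncn_le expR_ge0.
have Np := ltp _ _ a1 Nle.
apply: contrapT => none.
have rare y : (N0 <= y <= N)%N -> (sign_count (nonres p) true y)%:R <= eta * y%:R.
  move=> /andP[y1 yN]; rewrite leNgt; apply/negP => /ltW h; apply: none.
  exists y; split => //; first exact: leq_ltn_trans Np.
  by apply: le_trans Nle; rewrite ler_nat.
have eta1 : eta <= 1 / 32 by rewrite /eta /kappa; lra.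
have eta0 : 0 < eta by rewrite divr_gt0.
have S1 := neg_primes_rare eta0 eta1 N00 (nonres_mult pp oddp Np) rare.
(* Rarity of the nonresidue primes is known only up to N / N0. As N0 <= p^(eps/2), that range still
   reaches e^v. *)
pose v := (a0 + eps / 2) * L.
pose x := Num.truncn (expR ((1 / 4 + delta) * L)).
have xle : x%:R <= expR ((1 / 4 + delta) * L) by rewrite truncn_le expR_ge0.
have xp : (x < p)%N by apply: ltp xle; rewrite /delta; lra.
have ge1 : 1 <= expR ((1 / 4 + delta) * L)
  by rewrite -[X in X <= _](expR0 R) ler_expR; apply: mulr_ge0; [lra|exact: ltW].
have x0 : 1 <= x%:R :> R by rewrite ler1n truncn_gt0.
have xge : expR ((1 / 4 + delta) * L) / 2 <= x%:R.
  have : expR ((1 / 4 + delta) * L) < x.+1%:R by exact: truncnS_gt.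
  rewrite -natr1; lra.
have bur := Hb p pp pbp x ltac:(by rewrite xge xle).
rewrite sum_qchar_sign_count// in bur.
have vN : (Num.truncn (expR v) <= N %/ N0)%N.
  rewrite leq_divRL// /N truncn_ge_nat ?expR_ge0// natrM.
  apply: (@le_trans _ _ (expR v * expR (eps / 2 * L))).
    by apply: ler_pM => //; rewrite truncn_le expR_ge0.
  by rewrite -expRD ler_expR /v -mulrDl ler_pM2r//; lra.
have Vv : V <= v.
  have : V / (a0 + eps / 2) <= L by rewrite -ler_expR; move: F3; rewrite mul1r.
  by rewrite ler_pdivrMr //; rewrite ?/v; lra.
have S2 := HV v Vv.
have S3 : prime_recip R x <= prime_recip_exp (expR t * v).
  apply/prime_recip_le/le_truncn; rewrite ler_expR /v mulrA ler_pM2r//.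
have S4 := prime_recip_le R vN.
have S5 : recip_sum R (neg_prime (nonres p)) x <= 32 * eta + (t + kappa).
  have [xN|Nx] := leqP x (N %/ N0).
    apply: (@le_trans _ _ (recip_sum R (neg_prime (nonres p)) (N %/ N0)));
        last by apply: le_trans S1 _; rewrite lerDl addr_ge0// ltW.
    rewrite /recip_sum [X in _ <= X](@big_cat_nat _ _ _ x.+1)//= lerDl.
    by apply: sumr_ge0 => q _; rewrite invr_ge0.
  have := recip_sum_split R (ltnW Nx) (@neg_primeP (nonres p)).
  by move: S2 S3 S4 S1; rewrite /prime_recip_exp => *; lra.
have S6 := sign_count_le_recip R (nonres_mult pp oddp xp).
have S7 : x%:R * recip_sum R (neg_prime (nonres p)) x <= x%:R * (32 * eta + (t +
    kappa)).
  by rewrite ler_wpM2l.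
(* Burgess' estimate gives nonresidues up to [x] density at least 1/2 - kappa / 2, whereas S7 allows
   at most 32 eta + t + kappa = 1/2 - 3 kappa / 4. *)
move: bur; rewrite ler_norml => /andP[_ bur].
have kx : 0 < kappa * x%:R by rewrite mulr_gt0//; lra.
rewrite /eta /t in S7; lra.
Qed.

(** * Bohr sets and Beatty sequences *)

(** This is k times the Fejer kernel, the squared modulus of the sum of e^(i j x) for j < k. Natural
    frequencies |j - l| give it the form to which [daboussi_cos] applies. *)
Definition fejer (R : realType) (k : nat) (x : R) : R :=
  \sum_(j < k) \sum_(l < k) cos (`|j%:Z - l%:Z|%N%:R * x).

Lemma cos_natB (R : realType) (j l : nat) (x : R) :
  cos (`|j%:Z - l%:Z|%N%:R * x) = cos (j%:R * x - l%:R * x).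
Proof.
wlog lj : j l / (l <= j)%N.
  move=> H; case: (leqP l j) => [|/ltnW] h; first exact: H.
  by rewrite distnC H// -[RHS]cosN opprB.
by rewrite distnEl// natrB// mulrBl.
Qed.

Lemma fejerE (R : realType) (k : nat) (x : R) :
  fejer k x = (\sum_(j < k) cos (j%:R * x)) ^+ 2 + (\sum_(j < k) sin (j%:R * x)) ^+ 2.
Proof.
rewrite !expr2 !big_distrlr /= -big_split; apply: eq_bigr => j _.
by rewrite -big_split; apply: eq_bigr => l _; rewrite cos_natB cosB.
Qed.

(** Away from its peak the kernel is bounded independently of [k]: here sin^2 (x / 2) >= (1 - c) /
    2, and the cosine and sine sums are both at most 1 / |sin (x / 2)|. *)
Lemma fejer_le (R : realType) (k : nat) (x c : R) : cos x <= c -> c < 1 ->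
  fejer k x <= 4 / (1 - c).
Proof.
move=> xc c1.
have e : cos x = 1 - 2 * sin (x / 2) ^+ 2.
  have -> : cos x = cos (x / 2 + x / 2) by congr cos; field.
  by rewrite cosD; have := cos2Dsin2 (x / 2); rewrite !expr2; lra.
have s1 : (1 - c) / 2 <= sin (x / 2) ^+ 2 by lra.
have s0 : sin (x / 2) != 0 by apply/eqP => s0; move: s1; rewrite s0 expr0n /=; lra.
have sp : 0 < sin (x / 2) ^+ 2 by lra.
have h1 := @norm_sum_cos_le R x 0 0 k s0.
have h2 := @norm_sum_cos_le R x (- (pi / 2)) 0 k s0.
have sq (u : R) : `|u| <= `|sin (x / 2)|^-1 -> u ^+ 2 <= (sin (x / 2) ^+ 2)^-1.
  move=> hu; rewrite -real_normK ?num_real// -[X in _ <= X^-1]real_normK ?num_real//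
      -exprVn.
  by rewrite lerXn2r ?nnegrE ?invr_ge0.
have -> : 4 / (1 - c) = 2 * ((1 - c) / 2)^-1
  by rewrite invf_div; field; rewrite gt_eqF// subr_gt0.
apply: (@le_trans _ _ (2 * (sin (x / 2) ^+ 2)^-1)); last first.
  by rewrite ler_pM2l// lef_pV2 ?posrE//; lra.
rewrite fejerE [2 * _]mulr_natl mulr2n; apply: lerD; apply: sq.
  apply: le_trans h1; rewrite le_eqVlt; apply/orP; left; apply/eqP; congr `|_|.
  by rewrite big_mkord; apply: eq_bigr => i _; rewrite addr0 mulrC.
apply: le_trans h2; rewrite le_eqVlt; apply/orP; left; apply/eqP; congr `|_|.
by rewrite big_mkord; apply: eq_bigr => i _; rewrite cosBpihalf mulrC.
Qed.

Lemma distn_gt0 (j l : nat) : (0 < `|j%:Z - l%:Z|)%N = (j != l).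
Proof. by rewrite absz_gt0 subr_eq0. Qed.

Lemma distn_lt (j l k : nat) : (j < k)%N -> (l < k)%N -> (`|j%:Z - l%:Z| < k)%N.
Proof. lia. Qed.

Lemma uniform_threshold (P : nat -> nat -> Prop) (k : nat) :
  (forall j, (0 < j)%N -> exists N0, forall N, (N0 <= N)%N -> P j N) ->
  exists N0, forall j, (0 < j)%N -> (j < k)%N -> forall N, (N0 <= N)%N -> P j N.
Proof.
move=> H; elim: k => [|k [N1 IH]]; first by exists 0%N.
have [->|k0] := posnP k; first by exists 0%N => -[].
have [N2 H2] := H k k0; exists (maxn N1 N2) => j j0 jk N;
    rewrite geq_max => /andP[h1 h2].
by move: jk; rewrite ltnS leq_eqVlt => /orP[/eqP ->|jk]; [exact: H2|exact: IH].
Qed.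

(** The m of sign [s] are weighted with the kernel at th m + phi. Diagonal terms give k times their
    number [cnt]; the others lose at most k^2 e y = eta y / 4. Without a hit the kernel is at most C
    = 4 / (1 - c) at each such m > M0, while those up to M0 contribute at most M0 k^2 < eta y / 2.
    Since k >= C + 1, this would make [cnt] less than eta y. *)
Lemma sign_bohr_hit (R : realType) (th phi c eta : R) (M0 : nat) :
  (forall j, (0 < j)%N -> sin (j%:R * th / 2) != 0) -> c < 1 -> 0 < eta ->
  exists N0, forall y, (N0 <= y)%N -> forall neg s, mult_sign neg y ->
    eta * y%:R <= (sign_count neg s y)%:R ->
    exists m, [/\ (M0 < m)%N, (m <= y)%N, neg m = s & c < cos (th * m%:R + phi)].
Proof.
move=> sin0 c1 eta0.
pose C := 4 / (1 - c).
have C0 : 0 < C by rewrite divr_gt0 ?subr_gt0.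
pose k := (Num.truncn C).+2.
have kC : C + 1 <= k%:R.
  by have : C < (Num.truncn C).+1%:R := truncnS_gt _;
      rewrite /k -[in X in _ -> X]natr1; lra.
have k0 : 0 < k%:R :> R by rewrite ltr0n.
pose e := eta / (4 * k%:R ^+ 2).
have e0 : 0 < e by rewrite divr_gt0 ?mulr_gt0 ?exprn_gt0.
pose P j N := forall neg, mult_sign neg N -> forall s,
  `|\sum_(1 <= n < N.+1) (neg n == s)%:R * cos (j%:R * (th * n%:R + phi))| <= e * N%:R.
have [N1 HP] : exists N0, forall j, (0 < j)%N -> (j < k)%N -> forall N,
    (N0 <= N)%N -> P j N.
  apply: uniform_threshold => j j0.
  have sinj i : (0 < i)%N -> sin (i%:R * (j%:R * th) / 2) != 0.
    by move=> i0; rewrite mulrA -natrM sin0// muln_gt0 i0.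
  have [N1 H1] := daboussi_cos sinj e0.
  exists (maxn N1 (Num.truncn (`|sin (j%:R * th / 2)|^-1 / e)).+1) => N.
  rewrite geq_max => /andP[NN1 NN2] neg negm s.
  have b1 := H1 N NN1 neg negm (j%:R * phi).
  have b2 := norm_sum_cos_le (j%:R * phi) 1 N.+1 (sin0 j j0).
  have b3 : `|sin (j%:R * th / 2)|^-1 <= e * N%:R.
    rewrite [e * _]mulrC -ler_pdivrMr//; apply: ltW;
        apply: lt_le_trans (truncnS_gt _) _.
    by rewrite ler_nat.
  (* The indicator of sign [s] is half of 1 + (-1)^s (-1)^(neg n): a plain cosine sum plus a twisted
     one. *)
  have -> : \sum_(1 <= n < N.+1) (neg n == s)%:R * cos (j%:R * (th * n%:R + phi)) =
    (\sum_(1 <= n < N.+1) cos (j%:R * th * n%:R + j%:R * phi) +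
     (-1) ^+ s * \sum_(1 <= n < N.+1) (-1) ^+ neg n * cos (j%:R * th * n%:R + j%:R *
         phi)) / 2.
    rewrite mulr_sumr -big_split /= mulr_suml; apply: eq_bigr => n _.
    have -> : j%:R * (th * n%:R + phi) = j%:R * th * n%:R + j%:R * phi by ring.
    by case: (neg n); case: s => /=; rewrite ?expr0 ?expr1; field.
  rewrite normrM (@ger0_norm _ 2^-1)//;
      apply: le_trans (ler_wpM2r _ (ler_normD _ _)) _ => //.
  by rewrite normrM normr_sign mul1r; lra.
exists (maxn N1 (Num.truncn (2 * (M0%:R * k%:R ^+ 2) / eta)).+1) => y.
rewrite geq_max => /andP[yN1 yM] neg s negm dens.
apply: contrapT => none.
have yM' : 2 * (M0%:R * k%:R ^+ 2) < eta * y%:R.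
  rewrite [eta * _]mulrC -ltr_pdivrMr//; apply: lt_le_trans (truncnS_gt _) _.
  by rewrite ler_nat.
pose w n : R := (neg n == s)%:R.
pose x n := th * n%:R + phi.
pose cnt := (sign_count neg s y)%:R : R.
have cntE : cnt = \sum_(1 <= n < y.+1) w n by rewrite /cnt /sign_count natr_sum.
pose Z := \sum_(1 <= n < y.+1) w n * fejer k (x n).
have fk2 u : fejer k u <= k%:R ^+ 2.
  apply: (@le_trans _ _ (\sum_(j < k) \sum_(l < k) 1)).
    by apply: ler_sum => j _; apply: ler_sum => l _; exact: cos_le1.
  by rewrite !sumr_const !card_ord -mulrnA -natrX mulnn.
have up : Z <= C * cnt + M0%:R * k%:R ^+ 2.
  apply: (@le_trans _ _ (\sum_(1 <= n < y.+1) (C * w n + (n <= M0)%N%:R * k%:R ^+ 2))).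
    rewrite /Z big_nat_cond [X in _ <= X]big_nat_cond.
    apply: ler_sum => n /andP[/andP[n0 ny] _].
    have w0 : 0 <= w n by [].
    case: (leqP n M0) => nM.
      rewrite mul1r; apply: (@le_trans _ _ (k%:R ^+ 2));
          last by rewrite lerDr mulr_ge0// ltW.
      rewrite /w; case: (neg n == s); rewrite ?mul1r ?mul0r ?sqr_ge0//; exact: fk2.
    rewrite mul0r addr0 /w; case: eqP => ns; last by rewrite mul0r mulr0.
    rewrite mul1r mulr1; apply: fejer_le => //.
    by rewrite leNgt; apply/negP => h; apply: none; exists n; split.
  rewrite big_split /= -mulr_sumr -cntE lerD2l -mulr_suml ler_wpM2r ?sqr_ge0//.
  case: (leqP M0 y) => My; first by rewrite sum_nat_bool_leq.
  apply: (@le_trans _ _ (\sum_(1 <= n < y.+1) 1)); first by apply: ler_sum => n _;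
      rewrite lern1 leq_b1.
  by rewrite big_const_nat subSS subn0 iter_addr addr0 ler_nat ltnW.
have lo : k%:R * cnt - k%:R ^+ 2 * (e * y%:R) <= Z.
  have -> : Z = \sum_(j < k) \sum_(l < k) \sum_(1 <= n < y.+1) w n * cos (`|j%:Z -
      l%:Z|%N%:R * x n).
    rewrite /Z /fejer; under eq_bigr do rewrite mulr_sumr.
    rewrite exchange_big /=; apply: eq_bigr => j _; under eq_bigr do rewrite mulr_sumr.
    by rewrite exchange_big.
  have -> : k%:R * cnt - k%:R ^+ 2 * (e * y%:R) =
      \sum_(j < k) \sum_(l < k) ((j == l)%:R * cnt - e * y%:R).
    under eq_bigr => j _.
      rewrite sumrB sumr_const card_ord -mulr_suml.
      rewrite (bigD1 j) //= eqxx big1 ?addr0 ?mul1r; last by move=> i /negPf;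
          rewrite eq_sym => ->.
      over.
    rewrite sumr_const card_ord -[RHS]mulr_natl -[_ *+ k]mulr_natl; ring.
  apply: ler_sum => j _; apply: ler_sum => l _.
  have [->|jl] := eqVneq j l.
    rewrite mul1r distnn; under eq_bigr do rewrite mul0r cos0 mulr1.
    by rewrite -cntE lerBlDr lerDl mulr_ge0// ltW.
  rewrite mul0r sub0r.
  have d0 : (0 < `|j%:Z - l%:Z|)%N by rewrite distn_gt0 (inj_eq val_inj).
  have dk : (`|j%:Z - l%:Z| < k)%N by rewrite distn_lt.
  by have := HP _ d0 dk y yN1 neg negm s; rewrite ler_norml => /andP[].
have ke : k%:R ^+ 2 * (e * y%:R) = eta * y%:R / 4.
  by rewrite /e; field; rewrite gt_eqF.
have cn0 : 0 <= cnt by [].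
have kc : (C + 1) * cnt <= k%:R * cnt by rewrite ler_wpM2r.
have {}dens : eta * y%:R <= cnt := dens.
lra.
Qed.

Lemma legendre_nonsquare (p : nat) (z : int) : prime p -> odd p ->
  (z%:~R : 'F_p) ^+ p./2 = -1 -> legendre p z = -1.
Proof.
move=> pp oddp hz; have n1 := Fp_opp1_neq1 pp oddp.
have p20 : (0 < p./2)%N by have := prime_gt1 pp; have := oddp; lia.
have p0 : p%:R = 0 :> 'F_p := pcharf0 (pchar_Fp pp).
have dv (u : int) : (p%:Z %| u)%Z -> u%:~R = 0 :> 'F_p.
  by move=> /dvdzP[k ->]; rewrite intrM [X in _ * X]p0 mulr0.
rewrite /legendre; case: ifP => [/dv z0|_].
  by move: hz; rewrite z0 expr0n eqn0Ngt p20 /= => /eqP;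
      rewrite eq_sym oppr_eq0 oner_eq0.
case: ifP => // /existsP[x]; rewrite eqz_mod_dvd => /dv /eqP.
rewrite rmorphB /= subr_eq0 rmorphXn /= => /eqP xz.
move: hz n1; rewrite -xz -exprM mulnC exprM; set w := _%:~R ^+ _ => hw.
have [x0|x0] := eqVneq (((x : nat)%:Z)%:~R : 'F_p) 0.
  by move: hw; rewrite /w x0 expr0n eqn0Ngt p20 /= expr0n /= => /eqP;
      rewrite eq_sym oppr_eq0 oner_eq0.
by case: (Fp_exp_half pp oddp x0) => e; move: hw; rewrite /w e ?sqrrN expr1n => <-;
    rewrite eqxx.
Qed.

Lemma sin_pi_int (R : realType) (n : int) : sin (pi * n%:~R) = 0 :> R.
Proof.
have H (k : nat) : sin (pi * k%:R) = 0 :> R.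
  elim: k => [|k IH]; first by rewrite mulr0 sin0.
  by rewrite -natr1 mulrDr mulr1 sinDpi IH oppr0.
by case: n => k; [exact: H|rewrite NegzE mulrNz mulrN sinN H oppr0].
Qed.

Lemma sin_pi_eq0 (R : realType) (x : R) : sin (pi * x) = 0 -> exists n : int, x = n%:~R.
Proof.
move=> s0; exists (Num.floor x); set n := Num.floor x.
have /andP[n1 n2] := floor_itv x; rewrite -/n intrD in n1 n2.
apply/eqP; rewrite -subr_eq0; apply/eqP; set f := x - n%:~R.
have f0 : 0 <= f by rewrite subr_ge0.
have f1 : f < 1 by rewrite ltrBlDl.
have [//|fn0] := eqVneq f 0.
have fp : 0 < f by rewrite lt_def fn0.
have : 0 < sin (pi * f).
  by rewrite sin_gt0_pi// mulr_gt0 ?pi_gt0//= gtr_pMr ?pi_gt0.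
move: s0; have -> : pi * x = pi * f + pi * n%:~R by rewrite -mulrDr subrK.
rewrite sinD sin_pi_int mulr0 addr0 => /eqP;
    rewrite mulf_eq0 => /orP[/eqP -> //|/eqP c0]; first by rewrite ltxx.
have := cos2Dsin2 (pi * n%:~R : R).
by rewrite sin_pi_int c0 expr0n /= addr0 => /eqP; rewrite eq_sym oner_eq0.
Qed.

Lemma cos_2pi_subz (R : realType) (t : R) (n : int) :
  cos (2 * pi * (t - n%:~R)) = cos (2 * pi * t).
Proof.
have e : 2 * pi * n%:~R = pi * n%:~R + pi * n%:~R :> R by ring.
rewrite mulrBr cosB e cosD sinD sin_pi_int !mulr0 mul0r addr0 mulr0 addr0 subr0.
by have := cos2Dsin2 (pi * n%:~R : R); rewrite sin_pi_int expr0n addr0 expr2 => ->;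
    rewrite mulr1.
Qed.

Lemma cos_gt_near_int (R : realType) (t d : R) : 0 < d -> d <= 1 / 2 ->
  cos (2 * pi * d) < cos (2 * pi * t) -> exists n : int, `|t - n%:~R| < d.
Proof.
move=> d0 d1; pose n := Num.floor (t + 1 / 2); rewrite -(cos_2pi_subz t n).
have /andP[n1 n2] := floor_itv (t + 1 / 2); rewrite -/n intrD in n1 n2.
set u := t - n%:~R; have u1 : `|u| <= 1 / 2
  by rewrite ler_norml /u; apply/andP; split; lra.
have p0 := pi_gt0 R.
have -> : cos (2 * pi * u) = cos (2 * pi * `|u|).
  by case: (ger0P u) => // _; rewrite mulrN cosN.
have b (v : R) : 0 <= v -> v <= 1 / 2 -> 2 * pi * v \in `[0, pi].
  move=> v0 v1; rewrite in_itv /=; apply/andP; split; first by rewrite !mulr_ge0// ltW.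
  have : pi * v <= pi * (1 / 2) :> R by rewrite ler_pM2l.
  lra.
rewrite ltr_cos ?b ?(ltW d0)// ltr_pM2l ?mulr_gt0// => h.
by exists n.
Qed.

Lemma least_nonresidue_index_le (R : realType) (alpha beta : R) (p n : nat) :
  (0 < n)%N -> legendre p (Num.floor (alpha * n%:R + beta)) = -1 ->
  (least_nonresidue_index alpha beta p <= n%:R%:E)%E.
Proof.
move=> n0 hn; have ni : nonresidue_index alpha beta p n
  by rewrite /nonresidue_index /= n0 hn eqxx.
rewrite /least_nonresidue_index; case: pselect => [ex|]; last by case; exists n.
by rewrite lee_fin ler_nat; case: ex_minnP => m _; apply.
Qed.

Lemma irrational_sin_neq0 (R : realType) (alpha : R) : @irrational R alpha ->
  forall j, (0 < j)%N -> sin (j%:R * (2 * pi / `|alpha|) / 2) != 0.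
Proof.
move=> irr j j0; apply/eqP.
have a0 : alpha != 0.
  apply/eqP => a0; apply: irr; apply/rationalP; exists 0, 1%N.
  by rewrite a0 mul0r.
have na0 : 0 < `|alpha| by rewrite normr_gt0.
have -> : j%:R * (2 * pi / `|alpha|) / 2 = pi * (j%:R / `|alpha|)
  by field; rewrite gt_eqF.
move=> /sin_pi_eq0[n hn].
have jR : 0 < j%:R :> R by rewrite ltr0n.
have n0 : 0 < n%:~R :> R by rewrite -hn divr_gt0.
case: n n0 hn => [n|n]; last by rewrite NegzE mulrNz oppr_gt0 ltrn0.
move=> n0 hn; have aE : `|alpha| = j%:R / n%:R.
  by have := hn; rewrite -pmulrn => <-; rewrite invf_div mulrCA divff ?mulr1// gt_eqF.
apply: irr; apply/rationalP.
case: (ger0P alpha) aE => _ aE; first by exists j%:Z, n.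
by exists (- j%:Z), n; rewrite mulrNz mulNr -aE opprK.
Qed.

(** With t = m / |alpha| + (1/2 - beta) / alpha, the value alpha t + beta is sg m + 1/2, the centre
    of a unit interval. Replacing t by n moves it by less than 1/2, so the floor is sg m. *)
Lemma floor_beatty (R : realType) (alpha beta : R) (sg m n : int) :
  alpha != 0 -> sg%:~R * `|alpha| = alpha -> `|sg%:~R : R| = 1 ->
  `|m%:~R / `|alpha| + (1 / 2 - beta) / alpha - n%:~R| < 1 / (2 * `|alpha|) ->
  Num.floor (alpha * n%:~R + beta) = sg * m.
Proof.
move=> a0 sgE sg1 h.
have na0 : 0 < `|alpha| by rewrite normr_gt0.
have ag : alpha / `|alpha| = sg%:~R by rewrite -{1}sgE mulfK// gt_eqF.
set t := _ + _ / alpha in h.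
have e : alpha * t = (sg * m)%:~R + (1 / 2 - beta).
  rewrite /t mulrDr; congr (_ + _); last by rewrite mulrCA divff ?mulr1.
  by rewrite mulrCA ag intrM mulrC.
have : `|alpha * (t - n%:~R)| < 1 / 2.
  rewrite normrM; have := h; rewrite -(ltr_pM2l na0).
  by have -> : `|alpha| * (1 / (2 * `|alpha|)) = 1 / 2 by field; rewrite gt_eqF.
rewrite ltr_norml => /andP[h1 h2]; apply: floor_def; rewrite intrD.
by apply/andP; split; lra.
Qed.

Theorem theorem2p2 (R : realType) (alpha beta : R)
    (alpha_irr : @irrational R alpha) (eps : R) (eps_gt0 : 0 < eps) :
  exists p0 : nat, forall p : nat, prime p -> (p0 <= p)%N ->
    (least_nonresidue_index alpha beta p <=
       (p%:R `^ (1 / (4 * Num.sqrt (expR 1)) + eps))%:E)%E.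
Proof.
have a0 : alpha != 0.
  apply/eqP => a0; apply: alpha_irr; apply/rationalP; exists 0, 1%N.
  by rewrite a0 mul0r.
have na0 : 0 < `|alpha| by rewrite normr_gt0.
pose gamma := 1 / `|alpha|.
have g0 : 0 < gamma by rewrite divr_gt0.
pose sg : int := if 0 < alpha then 1 else -1.
have sgE : sg%:~R * `|alpha| = alpha.
  rewrite /sg; case: ltP => h; first by rewrite mul1r gtr0_norm.
  by rewrite mulN1r ler0_norm ?opprK.
have sg1 : `|sg%:~R : R| = 1 by rewrite /sg; case: ifP; rewrite ?normrN1 ?normr1.
pose phi0 := (1 / 2 - beta) / alpha.
(* gamma / 2 is the radius required by [floor_beatty]; up to 1/2, cos (2 pi t) determines the
   distance from t to the nearest integer. *)
pose d := Num.min (gamma / 2) (1 / 2).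
have d0 : 0 < d by rewrite lt_min; apply/andP; split; lra.
have d1 : d <= 1 / 2 by rewrite ge_min lexx orbT.
have dg : d <= gamma / 2 by rewrite ge_min lexx.
pose c : R := cos (2 * pi * d).
have p0 := pi_gt0 R.
have c1 : c < 1.
  have pd := ler_wpM2l (ltW p0) d1; have pd0 : 0 < 2 * pi * d by rewrite !mulr_gt0.
  have b0 : (0 : R) \in `[0, pi] by rewrite in_itv /= lexx ltW.
  have bd : 2 * pi * d \in `[0, pi] by rewrite in_itv /=; apply/andP; split; lra.
  by rewrite /c -[X in _ < X](@cos0 R) ltr_cos.
have eps2 : 0 < eps / 2 by lra.
have [eta eta0 Hdense] := sign_count_dense eps2.
(* Beyond [M0], gamma m >= |phi0| + 1; an integer n within 1/2 of gamma m + phi0 is then positive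
   and at most 2 gamma m. *)
pose M0 := Num.truncn ((`|phi0| + 1) / gamma).
have [N0 Hhit] := @sign_bohr_hit R (2 * pi / `|alpha|) (2 * pi * phi0) c eta M0.+1
  (irrational_sin_neq0 alpha_irr) c1 eta0.
have [p1 Hp1] := Hdense N0.+1 isT.
have [p2 Hp2] := @expR_ln_nat_large R (2 * gamma) (eps / 2) eps2.
exists (maxn 3 (maxn p1 p2)) => p pp.
rewrite !geq_max => /and3P[p_3 /(Hp1 p pp){Hp1}Hp1 /Hp2{Hp2}Hp2].
have oddp : odd p by case: (even_prime pp) p_3 => [->|].
have pR : p%:R != 0 :> R by rewrite pnatr_eq0 -lt0n prime_gt0.
have -> : Num.sqrt (expR 1) = expR (1 / 2) :> R.
  have -> : expR 1 = expR (1 / 2) ^+ 2 :> R by rewrite expr2 -expRD; congr expR; lra.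
  by rewrite sqrtr_sqr gtr0_norm ?expR_gt0.
rewrite /powR (negPf pR).
have n1 := Fp_opp1_neq1 pp oddp.
(* The sign that m must have for sg m to be a nonresidue: negative if sg is a residue, positive
   otherwise. *)
pose s : bool := (sg%:~R : 'F_p) ^+ p./2 == 1.
have sgF : (sg%:~R : 'F_p) ^+ p./2 = 1 \/ (sg%:~R : 'F_p) ^+ p./2 = -1.
  apply: Fp_exp_half => //; rewrite /sg; case: ifP => _; first exact: oner_neq0.
  by rewrite mulrNz oppr_eq0 oner_neq0.
have [y [y1 yp y2 y3]] := Hp1 s.
have [m [mM my ms mc]] := Hhit y (ltnW y1) _ s (nonres_mult pp oddp yp) y3.
pose t := m%:R / `|alpha| + phi0.
have /(cos_gt_near_int d0 d1)[n hn] : c < cos (2 * pi * t).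
  by apply: lt_le_trans mc _; rewrite le_eqVlt; apply/orP; left; apply/eqP;
      congr cos; rewrite /t; ring.
have ndist : `|t - n%:~R| < 1 / (2 * `|alpha|).
  by apply: lt_le_trans hn _; apply: le_trans dg _; rewrite /gamma invfM; lra.
have tE : t = gamma * m%:R + phi0 by rewrite /t /gamma; ring.
have gm : `|phi0| + 1 <= gamma * m%:R.
  rewrite [gamma * _]mulrC -ler_pdivrMr//; apply: ltW;
      apply: lt_le_trans (truncnS_gt _) _.
  by rewrite ler_nat ltnW.
have ph : `|phi0| <= `|phi0| := lexx _; rewrite ler_norml in ph.
move: ph => /andP[ph1 ph2].
have := lt_le_trans hn d1; rewrite ltr_norml => /andP[hn1 hn2].
have npos : 0 < n%:~R :> R by lra.
case: n npos hn ndist hn1 hn2 => [k|k]; last by rewrite NegzE mulrNz oppr_gt0 ltrn0.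
move=> kpos hn ndist hn1 hn2.
have fl : Num.floor (alpha * k%:R + beta) = sg * m%:Z := @floor_beatty R alpha beta
    sg m%:Z k%:Z a0 sgE sg1 ndist.
have k0 : (0 < k)%N by rewrite -(ltr_nat R).
apply: (@le_trans _ _ k%:R%:E).
  apply: least_nonresidue_index_le => //; rewrite fl.
  apply: legendre_nonsquare => //; rewrite intrM exprMn.
  have mp : (m < p)%N by exact: leq_ltn_trans yp.
  have m0 : (0 < m)%N by exact: leq_trans mM.
  move: ms; rewrite /s /nonres.
  case: (Fp_exp_half pp oddp (Fp_natr_neq0 pp m0 mp)) => em; rewrite -pmulrn em;
    case: sgF => ->; rewrite ?eqxx ?(negPf n1) ?mulr1 ?mul1r ?mulrNN ?mulr1//.
  by rewrite eq_sym (negPf n1).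
rewrite lee_fin; have kle : k%:R <= 2 * gamma * m%:R.
  by have kE : (Posz k)%:~R = k%:R :> R := erefl _; rewrite kE in hn1 hn2; lra.
apply: le_trans kle _.
have -> : 1 / (4 * expR (1 / 2)) + eps = eps / 2 + (1 / (4 * expR (1 / 2)) + eps / 2)
    by lra.
rewrite [(eps / 2 + _) * _]mulrDl expRD; apply: ler_pM => //.
  by rewrite mulr_ge0// ltW.
by apply: le_trans y2; rewrite ler_nat.
Qed.
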